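(* Let $H$ be a 3-connected cubic graph that has no 3-decomposition and that has the minimum number of vertices among all 3-connected cubic graphs without a 3-decomposition. Then $H$ contains none of the following six graphs as a subgraph: the triangle $K_3$; the complete bipartite graph $K_{2,3}$; the Petersen graph with one vertex removed; the claw-square; the twin-house; the domino.
   Context: All graphs are finite and simple; cubic means 3-regular. A 3-decomposition of a graph $G$ is a partition of $E(G)$ into the edge sets of a spanning tree, a (possibly empty) 2-regular subgraph, and a (possibly empty) matching. The claw-square is the graph on vertices $a_1,a_2,a_3,a_4,b_1,b_2,b_3,c$ with edges $a_1a_2,a_2a_3,a_3a_4,a_4a_1$ (a 4-cycle), $cb_1,cb_2,cb_3$ and $b_1a_1,b_2a_2,b_3a_3$. The twin-house is the graph on vertices $p_1,\dots,p_6$ with edges $p_1p_2,p_1p_5,p_2p_6,p_5p_3,p_5p_4,p_6p_3,p_6p_4$. The domino is the $2\times 3$ grid graph, i.e. vertices $a_1,a_2,a_3,b_1,b_2,b_3$ with edges $a_1a_2,a_2a_3,b_1b_2,b_2b_3,a_1b_1,a_2b_2,a_3b_3$ (two 4-cycles sharing an edge). *)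

(* Defs.v *)
From mathcomp Require Import all_boot.
Set Implicit Arguments.
Unset Strict Implicit.
Unset Printing Implicit Defensive.

Section Graphs.
Variable T : finType.

Definition simple_graph (e : rel T) : Prop := symmetric e /\ irreflexive e.

Definition edges (e : rel T) : {set {set T}} :=
  [set [set p.1; p.2] | p in [set p : T * T | e p.1 p.2]].

Definition cubic (e : rel T) : Prop := forall x : T, #|[set y | e x y]| = 3.

Definition connected_minus (e : rel T) (S : {set T}) : Prop :=
  forall x y, x \notin S -> y \notin S ->
    connect [rel u v | e u v && (u \notin S) && (v \notin S)] x y.

Definition k_connected (k : nat) (e : rel T) : Prop :=
  k < #|T| /\ forall S : {set T}, #|S| < k -> connected_minus e S.

Definition adjF (F : {set {set T}}) : rel T := fun x y => [set x; y] \in F.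
Definition degF (F : {set {set T}}) (v : T) : nat := #|[set f in F | v \in f]|.

Definition has_cycle (F : {set {set T}}) : Prop :=
  exists s : seq T, [/\ 2 < size s, uniq s & cycle (adjF F) s].

Definition spanning_tree (F : {set {set T}}) : Prop :=
  (forall x y : T, connect (adjF F) x y) /\ ~ has_cycle F.

(* 2-regular subgraph (possibly empty): every vertex it covers has degree 2. *)
Definition two_regular (F : {set {set T}}) : Prop :=
  forall v : T, degF F v = 0 \/ degF F v = 2.

Definition matching (F : {set {set T}}) : Prop :=
  forall v : T, degF F v <= 1.

Definition has_3decomposition (e : rel T) : Prop :=
  exists F1 F2 F3 : {set {set T}},
    [/\ F1 :|: F2 :|: F3 = edges e,
        [&& [disjoint F1 & F2], [disjoint F1 & F3] & [disjoint F2 & F3]],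
        spanning_tree F1, two_regular F2 & matching F3].

End Graphs.

Definition graph_of (n : nat) (s : seq (nat * nat)) : rel 'I_n :=
  fun u v => ((nat_of_ord u, nat_of_ord v) \in s) || ((nat_of_ord v, nat_of_ord u) \in s).

Definition contains_subgraph (T : finType) (e : rel T) (n : nat) (g : rel 'I_n) : Prop :=
  exists f : 'I_n -> T, injective f /\ forall u v, g u v -> e (f u) (f v).

Definition K3 : rel 'I_3 := graph_of [:: (0,1); (1,2); (2,0)].
Definition K23 : rel 'I_5 :=
  graph_of [:: (0,2); (0,3); (0,4); (1,2); (1,3); (1,4)].
(* Petersen graph: outer 5-cycle 0..4, spokes i--i+5, inner pentagram;
   vertex 9 removed. *)
Definition petersen_minus_vertex : rel 'I_9 :=
  graph_of [:: (0,1); (1,2); (2,3); (3,4); (4,0);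
                 (0,5); (1,6); (2,7); (3,8);
                 (5,7); (6,8); (8,5)].
(* claw-square: a1..a4 = 0..3, b1..b3 = 4..6, c = 7 *)
Definition claw_square : rel 'I_8 :=
  graph_of [:: (0,1); (1,2); (2,3); (3,0); (7,4); (7,5); (7,6);
                 (4,0); (5,1); (6,2)].
(* twin-house: p_i = i-1 *)
Definition twin_house : rel 'I_6 :=
  graph_of [:: (0,1); (0,4); (1,5); (4,2); (4,3); (5,2); (5,3)].
(* domino: a1..a3 = 0..2, b1..b3 = 3..5 *)
Definition domino : rel 'I_6 :=
  graph_of [:: (0,1); (1,2); (3,4); (4,5); (0,3); (1,4); (2,5)].

(* Main.v *)
From HB Require Import structures.
From mathcomp Require Import all_boot zify.
Require Import Defs.
Set Implicit Arguments.
Unset Strict Implicit.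
Unset Printing Implicit Defensive.

(** Colour each edge of a cubic graph as tree, cycle or matching edge.  The
colouring is a 3-decomposition iff every vertex sees (3,0,0), (2,0,1) or (1,2,0)
edges of the three colours, the tree edges connect the graph, and the tree degrees
add up to [2 (|V| - 1)].  All but the connectivity is local, so an occurrence [X]
of a forbidden subgraph can be exchanged for a smaller gadget [X']: what matters of
the rest of the graph is the colours of the edges leaving [X] (the stubs) and which
of their outer ends are joined by outside tree edges.  A finite check over these
data shows that every 3-decomposition after the exchange yields one before it; here
a matching stub may be turned into a tree stub, because its outer end has type
(2,0,1).

The graphs with three stubs are exchanged for a vertex.  Those with four stubs are
exchanged for an edge whose ends carry two stubs each.  Since 3-connectivity of a
cubic graph is 3-edge-connectivity, a pairing of the stubs is bad only if a single
outside edge separates the two pairs, and by submodularity of cuts two pairings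
cannot both be bad.  For the domino the second pairing alone does not suffice, but
the bridge of the first, bad, pairing excludes the remaining case. *)

(** * Counting the edges of trees *)

Section Trees.
Variable V : finType.
Implicit Types (t : rel V) (x y : V) (A : pred V).

(** The arc is the first one by which a path from [x] leaves [A]. That its tail is reachable from
    [x] matters later, when two tree paths cross the same bridge. *)
Lemma connect_crossing t A x y : connect t x y -> A x -> ~~ A y ->
  exists u v, [/\ connect t x u, A u, ~~ A v & t u v].
Proof.
case/connectP=> p; elim: p x => [|z p IHp] x /=; first by move=> _ -> ->.
case/andP=> txz tp def_y Ax nAy; case Az: (A z); last first.
  by exists x, z; rewrite connect0 Az.
have [u [v [zu Au Av tuv]]] := IHp z tp def_y Az nAy.
by exists u, v; split=> //; apply: connect_trans zu; apply: connect1.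
Qed.

(** Ordered pairs: an edge of a symmetric relation counts twice. Hence the equations [n + 2 = 2 * m]
    below, which say that a tree on [m] vertices has [m - 1] edges. *)
Definition arcs t : {set V * V} := [set p | t p.1 p.2].

Definition all_connected t := forall x y, connect t x y.

Definition edge_cycle t := exists s, [/\ 2 < size s, uniq s & cycle t s].

(** The tree grows by one vertex and both orientations of one edge at a time, along an arc by which
    [t] leaves [S]. *)
Lemma spanning_tree_upto t (r : V) k : symmetric t -> all_connected t ->
  0 < k <= #|V| -> exists (S : {set V}) (E : {set V * V}),
  [/\ #|S| = k, r \in S, #|E| + 2 = 2 * k,
      forall x y, (x, y) \in E -> [&& t x y, x \in S, y \in S & (y, x) \in E]
    & {in S, forall x, connect (fun a b => (a, b) \in E) r x}].
Proof.
move=> sym_t con_t; elim: k => // -[_ _|k IHk /andP[_ ltkV]].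
  exists [set r], set0; rewrite cards1 set11 cards0; split=> // [x y|x].
    by rewrite in_set0.
  by move/set1P->; apply: connect0.
have [|S [E [cardS rS cardE subE conE]]] := IHk; first by rewrite /= ltnW.
have [w wS]: exists w, w \notin S.
  apply/existsP; apply: contraLR ltkV; rewrite negb_exists => /forallP allS.
  rewrite -leqNgt -cardS; apply: subset_leq_card; apply/subsetP=> x _.
  by have:= allS x; rewrite negbK.
have [u [v [_ uS vS tuv]]] :=
  @connect_crossing t [pred z | z \in S] r w (con_t r w) rS wS.
rewrite /= in uS vS.
exists (v |: S), ((u, v) |: ((v, u) |: E)).
have neq_uv: (u, v) != (v, u).
  by apply/eqP=> -[eq_uv _]; rewrite -eq_uv uS in vS.
have vuE: (v, u) \notin E.
  by apply/negP=> /subE/and4P[_]; rewrite (negbTE vS).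
have uvE: (u, v) \notin E.
  by apply/negP=> /subE/and4P[_ _]; rewrite (negbTE vS).
split.
- by rewrite cardsU1 vS cardS.
- by rewrite inE rS orbT.
- by rewrite !cardsU1 !inE negb_or neq_uv uvE vuE; lia.
- move=> x y; rewrite !inE => /or3P[/eqP[-> ->]|/eqP[-> ->]|/subE/and4P[-> -> -> ->]].
  + by rewrite tuv uS !eqxx !orbT.
  + by rewrite sym_t tuv uS !eqxx !orbT.
  + by rewrite !orbT.
have conE' x: x \in S ->
    connect (fun a b => (a, b) \in (u, v) |: ((v, u) |: E)) r x.
  move/conE; apply: connect_sub => a b abE; apply: connect1.
  by rewrite !inE abE !orbT.
move=> x /setU1P[->|]; last exact: conE'.
by apply: connect_trans (conE' _ uS) _; apply: connect1; rewrite !inE eqxx.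
Qed.

Lemma spanning_tree_arcs t : symmetric t -> all_connected t -> 0 < #|V| ->
  exists E : {set V * V}, [/\ #|E| + 2 = 2 * #|V|,
    forall x y, (x, y) \in E -> t x y && ((y, x) \in E)
    & all_connected (fun a b => (a, b) \in E)].
Proof.
move=> sym_t con_t V_gt0; have [r _] := card_gt0P V_gt0.
have [|S [E [cardS _ cardE subE conE]]] := @spanning_tree_upto t r #|V| sym_t con_t.
  by rewrite V_gt0 /=.
have defS x : x \in S.
  suff ->: S = setT by rewrite in_setT.
  by apply/eqP; rewrite eqEcard subsetT cardsT cardS leqnn.
exists E; split=> // [x y /subE/and4P[-> _ _ ->] //|x y].
have symE: symmetric (fun a b => (a, b) \in E).
  by move=> a b; apply/idP/idP=> /subE/and4P[].
by apply: connect_trans (conE _ (defS y)); rewrite (sym_connect_sym symE) conE.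
Qed.

Lemma connected_arcs t : symmetric t -> all_connected t -> 0 < #|V| ->
  2 * #|V| <= #|arcs t| + 2.
Proof.
move=> sym_t con_t /(spanning_tree_arcs sym_t con_t)[E [<- subE _]].
rewrite leq_add2r; apply: subset_leq_card; apply/subsetP=> -[x y] /subE/andP[txy _].
by rewrite inE.
Qed.

(** A spanning tree [E] inside [t] has the right number of arcs, and an arc of [t] outside [E] would
    close a simple path of [E] to a cycle. *)
Lemma acyclic_arcs t : symmetric t -> irreflexive t -> all_connected t ->
  0 < #|V| -> ~ edge_cycle t -> #|arcs t| + 2 = 2 * #|V|.
Proof.
move=> sym_t irr_t con_t /(spanning_tree_arcs sym_t con_t)[E [<- subE conE]] acy.
congr (_ + 2); apply: eq_card => -[x y]; rewrite inE /=.
apply/idP/idP=> [txy|/subE/andP[] //]; apply/negPn/negP=> xyE; case: acy.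
have /connectP[p0 Ep0 def_y] := conE x y.
have: last x p0 = y by []; case/shortenP: Ep0 => p Ep Up _ def_y'.
exists (x :: p); split=> //.
(* The cycle is long enough: an empty path would give a loop, a path of one arc would put [(x, y)]
   in [E]. *)
- move: Ep def_y' {Up}; case: p => [|z [|w p]] //=.
    by move=> _ eq_xy; rewrite eq_xy irr_t in txy.
  by rewrite andbT => Exz eq_zy; rewrite -eq_zy Exz in xyE.
rewrite /= rcons_path def_y' sym_t txy andbT.
by apply: sub_path Ep => a b /subE/andP[].
Qed.

(** Without one edge of a cycle the graph is still connected, but has two arcs fewer than
    [connected_arcs] requires. *)
Lemma arcs_acyclic t : symmetric t -> all_connected t ->
  #|arcs t| + 2 = 2 * #|V| -> ~ edge_cycle t.
Proof.
move=> sym_t con_t card_t [[|x [|y [|z p]]]] [] // _ Us /= /andP[txy cyc].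
pose t' := [rel a b | [&& t a b, (a, b) != (x, y) & (a, b) != (y, x)]].
have neq_xy: x != y by move: Us; rewrite /= !inE !negb_or => /andP[/and3P[]].
have xP: x \notin [:: y, z & p] by case/andP: Us.
have yP: y \notin z :: p by case/and3P: Us.
have con_yx: connect t' y x.
  apply/connectP; exists (rcons (z :: p) x); last by rewrite last_rcons.
  have: path t y (rcons (z :: p) x) := cyc; rewrite !rcons_path.
  (* The rest of the cycle leads from [y] to [x]: all its arcs but the last avoid [x], and the last
     does not start at [y]. *)
  case/andP=> tp tl; apply/andP; split.
    apply: (@sub_in_path _ [pred a | a != x] t) tp.
      move=> a b; rewrite !inE => neq_a neq_b tab; rewrite /t' /= tab !xpair_eqE.
      by rewrite (negbTE neq_a) (negbTE neq_b) andbF.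
    by apply/allP=> a aP; apply: contraNneq xP => <-.
  rewrite /t' /= tl !xpair_eqE /= [x == y](negbTE neq_xy) andbF /=.
  rewrite eqxx andbT; apply: contraNneq yP => {1}<-.
  exact: mem_last.
have sym_t': symmetric t'.
  by move=> a b; rewrite /t' /= sym_t !xpair_eqE; congr (_ && _);
     rewrite andbC; congr (_ && _); rewrite andbC.
have con_t': all_connected t'.
  move=> a b; apply: connect_sub (con_t a b) => {}a {}b tab.
  have [/eqP[-> ->]|neq1] := boolP ((a, b) == (x, y)).
    by rewrite (sym_connect_sym sym_t').
  have [/eqP[-> ->]//|neq2] := boolP ((a, b) == (y, x)).
  by apply: connect1; rewrite /t' /= tab neq1.
have V_gt0: 0 < #|V| by apply/card_gt0P; exists x.
have:= connected_arcs sym_t' con_t' V_gt0.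
have ->: arcs t' = arcs t :\ (x, y) :\ (y, x).
  by apply/setP=> -[a b]; rewrite !inE /= andbC andbCA -andbA; congr (_ && _).
have:= cardsD1 (x, y) (arcs t); have:= cardsD1 (y, x) (arcs t :\ (x, y)).
rewrite !inE /= txy sym_t txy !xpair_eqE (negbTE neq_xy) eq_sym (negbTE neq_xy) /=.
by move=> e2 e1; rewrite -card_t e1 e2; move: #|_| => N; lia.
Qed.

End Trees.

(** * Decompositions as edge colourings *)

Inductive color := Absent | Tree | Cycle | Match.

Definition color_eqb (a b : color) : bool :=
  match a, b with
  | Absent, Absent | Tree, Tree | Cycle, Cycle | Match, Match => true
  | _, _ => false
  end.

Lemma color_eqP : Equality.axiom color_eqb.
Proof. by case; case; constructor. Qed.

HB.instance Definition _ := hasDecEq.Build color color_eqP.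

(** The splittings of degree 3 with cycle degree 0 or 2, matching degree at most 1 and positive tree
    degree. *)
Definition vertex_ok (nT nC nM : nat) : bool :=
  (nT, nC, nM) \in [:: (3, 0, 0); (2, 0, 1); (1, 2, 0)].

Section Colorings.
Variable V : finType.
Implicit Types (e : rel V) (c : V -> V -> color) (F : {set {set V}}).

Definition cdeg c k x := \sum_y (c x y == k).

(** Acyclicity is replaced by an edge count, which is additive over the two sides of a glued
    graph. *)
Definition decomposing c := [/\ forall x y, c x y = c y x,
  forall x, vertex_ok (cdeg c Tree x) (cdeg c Cycle x) (cdeg c Match x),
  all_connected (fun x y => c x y == Tree)
  & \sum_x cdeg c Tree x + 2 = 2 * #|V|].

Definition decomposable e :=
  exists2 c, forall x y, e x y = (c x y != Absent) & decomposing c.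

Lemma sum_card (P : pred V) : \sum_x P x = #|[set x | P x]|.
Proof.
rewrite -sum1_card [RHS]big_mkcond; apply: eq_bigr => x _.
by rewrite inE; case: (P x).
Qed.

Lemma sum_arcs (t : rel V) : \sum_x \sum_y t x y = #|arcs t|.
Proof.
rewrite pair_big -sum1_card [RHS]big_mkcond; apply: eq_bigr => -[x y] _.
by rewrite inE; case: (t x y).
Qed.

Lemma set2_inj (x y u v : V) :
  [set x; y] = [set u; v] -> (x = u /\ y = v) \/ (x = v /\ y = u).
Proof.
move=> eq_s; have: x \in [set u; v] by rewrite -eq_s set21.
have: y \in [set u; v] by rewrite -eq_s set22.
have: u \in [set x; y] by rewrite eq_s set21.
have: v \in [set x; y] by rewrite eq_s set22.
by do 4![case/set2P=> ?]; subst; auto.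
Qed.

Lemma set2_injr (x : V) : injective (fun y => [set x; y]).
Proof. by move=> y z /set2_inj[[_ ->]|[-> ->]]. Qed.

Lemma mem_edges e x y : symmetric e -> ([set x; y] \in edges e) = e x y.
Proof.
move=> sym_e; apply/imsetP/idP=> [[[u v]]|exy].
  by rewrite inE /= => euv /set2_inj[[-> ->]|[-> ->]] //; rewrite sym_e.
by exists (x, y); rewrite ?inE.
Qed.

Lemma degF_sum e F x : F \subset edges e -> degF F x = \sum_y ([set x; y] \in F).
Proof.
move=> subF; rewrite (sum_card (fun y => [set x; y] \in F)).
rewrite -(card_imset _ (@set2_injr x)) /degF.
apply: eq_card => f; rewrite inE; apply/andP/imsetP=> [[fF xf]|[y]].
  have /imsetP[[u v] _ /= def_f] := subsetP subF f fF.
  move: xf; rewrite def_f => /set2P[]eq_x; subst x.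
    by exists v; rewrite // inE -def_f.
  by exists u; rewrite ?inE setUC -?def_f.
by rewrite inE => yF ->; rewrite set21.
Qed.

Lemma decomposable_has_3decomposition e :
  symmetric e -> irreflexive e -> decomposable e -> has_3decomposition e.
Proof.
move=> sym_e irr_e [c def_e [sym_c ok_c con_c count_c]].
pose F k := [set [set p.1; p.2] | p in [set p : V * V | c p.1 p.2 == k]].
have memF k x y : ([set x; y] \in F k) = (c x y == k).
  by rewrite (@mem_edges (fun x y => c x y == k)) // => u v; rewrite sym_c.
have subF k : k != Absent -> F k \subset edges e.
  move=> k_ok; apply/subsetP=> _ /imsetP[[x y] + ->] /=; rewrite inE /= => /eqP.
  by move=> cxy; rewrite mem_edges // def_e cxy.
have degFk k x : k != Absent -> degF (F k) x = cdeg c k x.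
  move=> k_ok; rewrite (degF_sum _ (subF k k_ok)).
  by apply: eq_bigr => y _; rewrite memF.
have disF k l : k != l -> [disjoint F k & F l].
  move=> neq_kl; apply/pred0P=> f /=; apply/negP=> /andP[+ fl].
  case/imsetP=> -[x y]; rewrite inE => /= cxy def_f; move: fl; rewrite def_f memF.
  by rewrite (eqP cxy) (negbTE neq_kl).
exists (F Tree), (F Cycle), (F Match); split.
- apply/setP=> f; apply/idP/idP.
    by rewrite in_setU in_setU => /orP[/orP[]|]; apply/subsetP/subF.
  case/imsetP=> -[x y]; rewrite inE /= => exy ->; rewrite !in_setU !memF.
  by move: exy; rewrite def_e; case: (c x y).
- by rewrite !disF.
- have adj_tree x y : adjF (F Tree) x y = (c x y == Tree) by apply: memF.
  split=> [x y|]; first by rewrite (eq_connect adj_tree).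
  apply: arcs_acyclic.
  + by move=> x y; rewrite !adj_tree sym_c.
  + by move=> x y; rewrite (eq_connect adj_tree).
  + rewrite -count_c -sum_arcs; congr (_ + _); apply: eq_bigr => x _.
    by apply: eq_bigr => y _; rewrite adj_tree.
- move=> x; rewrite degFk //; have:= ok_c x.
  by rewrite /vertex_ok !inE => /or3P[]/eqP[_ -> _]; auto.
- move=> x; rewrite degFk //; have:= ok_c x.
  by rewrite /vertex_ok !inE => /or3P[]/eqP[_ _ ->].
Qed.

Lemma has_3decomposition_decomposable e :
  symmetric e -> irreflexive e -> cubic e -> 1 < #|V| ->
  has_3decomposition e -> decomposable e.
Proof.
move=> sym_e irr_e cub_e V_gt1 [F1 [F2 [F3 []]]].
move=> defF /and3P[dis12 dis13 dis23] [con1 acy1] reg2 mat3.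
have sub1 : F1 \subset edges e by rewrite -defF -setUA subsetUl.
have sub2 : F2 \subset edges e by rewrite -defF setUAC subsetUr.
have sub3 : F3 \subset edges e by rewrite -defF subsetUr.
pose c x y := if [set x; y] \in F1 then Tree else if [set x; y] \in F2 then Cycle
  else if [set x; y] \in F3 then Match else Absent.
have cT x y : (c x y == Tree) = ([set x; y] \in F1).
  by rewrite /c; case: (_ \in F1) => //; case: (_ \in F2) => //; case: (_ \in F3).
have cC x y : (c x y == Cycle) = ([set x; y] \in F2).
  rewrite /c; case: ifP => [inF1|_]; last by case: (_ \in F2) => //; case: (_ \in F3).
  by rewrite (disjointFr dis12 inF1).
have cM x y : (c x y == Match) = ([set x; y] \in F3).
  rewrite /c; case: ifP => [inF1|_]; first by rewrite (disjointFr dis13 inF1).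
  by case: ifP => [inF2|_]; [rewrite (disjointFr dis23 inF2) | case: ifP].
have def_e x y : e x y = (c x y != Absent).
  rewrite -mem_edges // -defF !inE -cT -cC -cM; by case: (c x y).
have degT x : cdeg c Tree x = degF F1 x.
  by rewrite (degF_sum _ sub1); apply: eq_bigr => y _; rewrite cT.
have degC x : cdeg c Cycle x = degF F2 x.
  by rewrite (degF_sum _ sub2); apply: eq_bigr => y _; rewrite cC.
have degM x : cdeg c Match x = degF F3 x.
  by rewrite (degF_sum _ sub3); apply: eq_bigr => y _; rewrite cM.
have con_c : all_connected (fun x y => c x y == Tree).
  by move=> x y; rewrite (eq_connect (cT : _ =2 adjF F1)).
exists c => //; split=> // [x y|x|].
- by rewrite /c setUC.
- have: cdeg c Tree x + cdeg c Cycle x + cdeg c Match x = 3.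
    rewrite -(cub_e x) -sum_card -!big_split; apply: eq_bigr => y _ /=.
    by rewrite def_e; case: (c x y).
  (* The tree must reach a second vertex. This rules out the splitting (0,2,1). *)
  have: 0 < cdeg c Tree x.
    have [y neq_yx]: exists y, y != x.
      apply/existsP; rewrite -[[exists _, _]]negbK negb_exists; apply/negP=> /forallP allx.
      have: #|V| <= #|[set x]|.
        by apply/subset_leq_card/subsetP=> y _; have:= allx y; rewrite negbK inE.
      by rewrite cards1 leqNgt V_gt1.
    have /connectP[[|z p] /= cp def_y] := con_c x y.
      by rewrite def_y eqxx in neq_yx.
    by case/andP: cp => cxz _; rewrite /cdeg (bigD1 z) //= cxz.
  rewrite degC degM; have:= mat3 x; rewrite /vertex_ok !inE.
  case: (reg2 x) => ->; case: (degF F3 x) => [|[]] //.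
  + by move=> _ _ /eqP; rewrite !addn0 => /eqP->.
  + by move=> _ _; rewrite addn0 addn1 => -[->].
  + by move=> _ _; rewrite addn0 addn2 => -[->].
  by move=> _; case: (cdeg c Tree x) => [|n] _ //; rewrite !addnS.
- rewrite -(@acyclic_arcs V (adjF F1)) //.
  + congr (_ + _); rewrite -sum_arcs; apply: eq_bigr => x _.
    by apply: eq_bigr => y _; rewrite cT.
  + by move=> x y; rewrite /adjF setUC.
  + move=> x; apply/negbTE; rewrite /adjF -cT.
    by apply: contraFN (irr_e x) => /eqP cxx; rewrite def_e cxx.
  + exact: ltnW.
Qed.

End Colorings.

Lemma decomposing_bij (V W : finType) (f : V -> W) c c' : bijective f ->
  (forall x y, c' x y = c (f x) (f y)) -> decomposing c -> decomposing c'.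
Proof.
move=> bij_f def_c' [sym_c ok_c con_c count_c].
have cdegE k x : cdeg c' k x = cdeg c k (f x).
  rewrite /cdeg [RHS](reindex f) /=; last exact: onW_bij.
  by apply: eq_bigr => y _; rewrite def_c'.
split.
- by move=> x y; rewrite !def_c' sym_c.
- by move=> x; rewrite !cdegE.
- case: bij_f => g fK gK x y.
  rewrite -(fK x) -(fK y); have:= con_c (f x) (f y); move: (f x) (f y) => {x y} x y.
  case/connectP=> p cp ->; apply/connectP; exists (map g p); last by rewrite last_map.
  elim: p x cp => //= z p IHp x /andP[cxz cp].
  by rewrite def_c' !gK cxz IHp.
- rewrite (bij_eq_card bij_f) -count_c [in RHS](reindex f) /=; last exact: onW_bij.
  by congr (_ + _); apply: eq_bigr => x _; rewrite cdegE.
Qed.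

(** * Vertex and edge connectivity of cubic graphs *)

Section EdgeConnectivity.
Variables (V : finType) (e : rel V).
Hypotheses (sym_e : symmetric e) (irr_e : irreflexive e).
Implicit Types (P Q A : pred V).

(** Ordered pairs are counted, so that [links P predT] is the degree sum over [P], while [cut A]
    counts every leaving edge once. *)
Definition links P Q := \sum_x \sum_y [&& P x, Q y & e x y].

Definition cut A := links A (predC A).

Definition three_edge_connected :=
  forall A, (exists x, A x) -> (exists x, ~~ A x) -> 3 <= cut A.

Definition three_regular := forall x, \sum_y e x y = 3.

Lemma cubic_three_regular : cubic e <-> three_regular.
Proof. by split=> reg_e x; have:= reg_e x; rewrite sum_card. Qed.

Lemma linksC P Q : links P Q = links Q P.
Proof.
rewrite /links exchange_big; apply: eq_bigr => x _; apply: eq_bigr => y _.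
by rewrite sym_e andbCA.
Qed.

(** The hypothesis, an equation of natural numbers, says that [P] is the disjoint union of [P1] and
    [P2]. *)
Lemma links_addl P P1 P2 Q : (forall x, P x = P1 x + P2 x :> nat) ->
  links P Q = links P1 Q + links P2 Q.
Proof.
move=> defP; rewrite -big_split; apply: eq_bigr => x _.
rewrite -big_split; apply: eq_bigr => y _ /=.
by have:= defP x; case: (P x) (P1 x) (P2 x) => [] [] [] //=; rewrite ?addn0.
Qed.

Lemma links_addr P Q Q1 Q2 : (forall x, Q x = Q1 x + Q2 x :> nat) ->
  links P Q = links P Q1 + links P Q2.
Proof. by move=> defQ; rewrite ![links P _]linksC; apply: links_addl. Qed.

Lemma cutC A : cut (predC A) = cut A.
Proof.
rewrite /cut linksC; apply: eq_bigr => x _; apply: eq_bigr => y _ /=.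
by rewrite negbK.
Qed.

Lemma links_eq0 P Q : (forall x y, P x -> Q y -> ~~ e x y) -> links P Q = 0.
Proof.
move=> noPQ; apply: big1 => x _; apply: big1 => y _; apply/eqP; rewrite eqb0.
by apply/negP=> /and3P[Px Qy]; apply/negP/noPQ.
Qed.

Lemma cut_eq_arcs A u v u' v' : cut A = 1 -> A u -> ~~ A v -> e u v ->
  A u' -> ~~ A v' -> e u' v' -> (u, v) = (u', v').
Proof.
rewrite /cut /links pair_big => cut1 Au nAv euv Au' nAv' euv'.
apply: contra_eq cut1 => neq_uv.
rewrite (bigD1 (u, v)) //= (bigD1 (u', v')) 1?eq_sym //=.
by rewrite Au nAv euv Au' nAv' euv' !addnA.
Qed.

(** If at most two edges leave [A], their ends in [A] form a set [S] of at most two vertices.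
    Removing [S] would separate the rest of [A] from [b], so [A] equals [S]; but so small a set in a
    cubic graph has at least three leaving edges. *)
Lemma edge_connected_of_connected : cubic e -> k_connected 3 e ->
  three_edge_connected.
Proof.
move=> /cubic_three_regular reg_e [_ con_e] A [a0 Aa0] [b nAb].
rewrite leqNgt; apply/negP=> lt_cut.
pose S := [set x | A x && [exists y, ~~ A y && e x y]].
have leS: #|S| <= cut A.
  rewrite -sum_card leq_sum // => x _; case: (A x) => //=.
  case: existsP => // -[y /andP[nAy exy]].
  by rewrite (bigD1 y) //= nAy exy.
have leA: #|[set x | A x]| <= 2.
  have [/existsP[a /andP[Aa aS]]|] := boolP [exists a, A a && (a \notin S)].
    have bS: b \notin S by rewrite inE (negbTE nAb).
    have [||u [v [au /andP[Au uS] nAv]]] := @connect_crossing _ _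
      [pred x | A x && (x \notin S)] a b (con_e S (leq_ltn_trans leS lt_cut) a b aS bS).
    - by rewrite /= Aa.
    - by rewrite /= (negbTE nAb).
    rewrite /= => /andP[/andP[euv _] vS]; rewrite /= vS andbT in nAv.
    by case/negP: uS; rewrite inE Au; apply/existsP; exists v; rewrite nAv.
  rewrite negb_exists => /forallP AS; apply: leq_trans (leq_trans leS _) => //.
  apply/subset_leq_card/subsetP=> x; rewrite inE => Ax.
  by have:= AS x; rewrite Ax negbK.
(* A vertex of [A] has at most [#|A| - 1] neighbours in [A], hence at least [4 - #|A|] outside. *)
have cut_ge: #|[set x | A x]| * (4 - #|[set x | A x]|) <= cut A.
  rewrite -sum_nat_const [leqLHS](eq_bigl A); last by move=> x; rewrite !inE.
  rewrite big_mkcond leq_sum // => x _; case: ifPn => // Ax.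
  have: \sum_y (A y && e x y) <= #|[set x | A x] :\ x|.
    rewrite sum_card; apply/subset_leq_card/subsetP=> y; rewrite !inE.
    by case/andP=> -> exy; rewrite andbT; apply: contraTneq exy => ->; rewrite irr_e.
  have:= cardsD1 x [set x | A x]; rewrite inE Ax.
  have: \sum_y (A y && e x y) + \sum_y (~~ A y && e x y) = 3.
    rewrite -(reg_e x) -big_split; apply: eq_bigr => y _ /=.
    by case: (A y) => //=; rewrite addn0.
  move: #|_| #|_| => m n; rewrite /=; lia.
have: 0 < #|[set x | A x]| by apply/card_gt0P; exists a0; rewrite inE.
by case: #|_| leA cut_ge => [|[|[|]]] //= _; lia.
Qed.

Lemma links_le3 P : three_regular -> #|[set x | P x]| <= 1 -> links P predT <= 3.
Proof.
move=> reg_e /card_le1_eqP P1; have [/existsP[x Px]|] := boolP [exists x, P x].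
  rewrite /links (bigD1 x) //= [X in _ + X]big1 ?addn0.
    by rewrite Px /= reg_e.
  move=> y neq_yx; apply: big1 => z _; case Py: (P y) => //=.
  by rewrite (P1 x y) ?inE ?eqxx // in neq_yx.
rewrite negb_exists => /forallP nP; rewrite links_eq0 // => x y Px.
by have:= nP x; rewrite Px.
Qed.

(* With [aP] the number of links from [P] to [A], and so on, the cuts around
   [A], [B], [A + P] and [A + Q] force [aP + aQ = 3] and [aP = aQ]. *)
Local Ltac by_parts part A B P Q :=
  let x := fresh "x" in
  by move=> x /=; have:= part x; case: (A x); case: (B x); case: (P x); case: (Q x).

Lemma three_edge_connected_split (A B P Q : pred V) : three_edge_connected ->
  (forall x, 1 = A x + B x + P x + Q x) -> links A B = 0 ->
  links P predT <= 3 -> links Q predT <= 3 ->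
  (exists x, A x) -> (exists x, B x) -> False.
Proof.
move=> ec_e part AB0 leP leQ [a Aa] [b Bb].
have split2 (R R1 R2 Q1 Q2 : pred V) : (forall x, R x = R1 x + R2 x :> nat) ->
    (forall x, 1 = R x + (Q1 x + Q2 x)) -> (exists x, R x) -> (exists x, Q1 x) ->
    3 <= links R1 Q1 + links R1 Q2 + (links R2 Q1 + links R2 Q2).
  move=> defR partR exR [x Q1x]; have defQ y : ~~ R y = Q1 y + Q2 y :> nat.
    by have:= partR y; case: (R y); case: (Q1 y); case: (Q2 y).
  rewrite -!(links_addr _ defQ) -(links_addl _ defR); apply: ec_e => //.
  by exists x; have:= partR x; rewrite Q1x; case: (R x).
have links_or (R R1 R2 : pred V) : (forall x, ~~ (R1 x && R2 x)) ->
    links R [pred x | R1 x || R2 x] = links R R1 + links R R2.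
  move=> disR; apply: links_addr => x /=.
  by have:= disR x; case: (R1 x); case: (R2 x).
have cutA := @split2 A A pred0 B [pred x | P x || Q x].
have cutB := @split2 B B pred0 A [pred x | P x || Q x].
have cutAP := @split2 [pred x | A x || P x] A P B Q.
have cutAQ := @split2 [pred x | A x || Q x] A Q B P.
have disPQ x : ~~ (P x && Q x) by move: x; by_parts part A B P Q.
have links0 R : links pred0 R = 0 by apply: links_eq0.
have {}linksE R : links R predT = links R A + links R B + (links R P + links R Q).
  rewrite (@links_addr _ _ [pred x | A x || B x] [pred x | P x || Q x]).
    by rewrite !links_or //; by_parts part A B P Q.
  by_parts part A B P Q.
rewrite !links_or // !links0 in cutA cutB.
have symL := linksC.
rewrite !linksE ![links _ A]symL ![links _ B]symL in leP leQ.
rewrite ![links _ A]symL AB0 in cutB.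
rewrite AB0 ![links P _]symL in cutAP.
rewrite AB0 ![links Q _]symL in cutAQ.
rewrite AB0 !addn0 add0n in cutA; rewrite !addn0 add0n in cutB.
have {}cutA : 3 <= links A P + links A Q.
  by apply: cutA; [by_parts part A B P Q.. | exists a | exists b].
have {}cutB : 3 <= links B P + links B Q.
  by apply: cutB; [by_parts part A B P Q.. | exists b | exists a].
have {}cutAP := cutAP ltac:(by_parts part A B P Q) ltac:(by_parts part A B P Q).
have {}cutAQ := cutAQ ltac:(by_parts part A B P Q) ltac:(by_parts part A B P Q).
have {}cutAP : 3 <= 0 + links A Q + (links B P + links Q P).
  by apply: cutAP; [exists a; rewrite /= Aa | exists b].
have {}cutAQ : 3 <= 0 + links A P + (links B Q + links P Q).
  by apply: cutAQ; [exists a; rewrite /= Aa | exists b].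
(* The degree bounds on [P] and [Q] make the first two cuts tight and leave no links between [P] and
   [Q]; the other two cuts then force [2 * links A P = 3]. *)
have := symL P Q; lia.
Qed.

(** If [S] separates [a] from [b], let [A] be the part reached from [a] and [B] the rest outside
    [S]; [three_edge_connected_split] refutes this. The vertex [x0] and its neighbours give the four
    vertices required. *)
Lemma connected_of_edge_connected (x0 : V) : cubic e -> three_edge_connected ->
  k_connected 3 e.
Proof.
move=> cub_e ec_e; have reg_e := cubic_three_regular.1 cub_e; split.
  have <-: #|x0 |: [set y | e x0 y]| = 4 by rewrite cardsU1 cub_e inE irr_e.
  exact: max_card.
move=> S ltS a b aS bS; set r := [rel u v | _]; apply/negPn/negP=> nab.
(* [S] is split into two sets of at most one vertex each, so that separators of size 0, 1 and 2 are
   treated alike. *)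
have [Ps [Pt [defS leP leQ]]] : exists Ps Pt : pred V,
    [/\ forall x, (x \in S) = Ps x + Pt x :> nat,
        #|[set x | Ps x]| <= 1 & #|[set x | Pt x]| <= 1].
  have [->|[s sS]] := set_0Vmem S.
    exists pred0, pred0; split=> [x||]; first by rewrite in_set0.
    - by rewrite (_ : [set x | _] = set0) ?cards0 //; apply/setP=> x; rewrite !inE.
    - by rewrite (_ : [set x | _] = set0) ?cards0 //; apply/setP=> x; rewrite !inE.
  exists (pred1 s), [pred x | x \in S :\ s]; split=> [x||].
  - by rewrite /= !inE; have [->|] := eqVneq x s; rewrite ?sS.
  - by rewrite (_ : [set x | _] = [set s]) ?cards1 //; apply/setP=> x; rewrite !inE.
  - rewrite (_ : [set x | _] = S :\ s); last by apply/setP=> x; rewrite inE.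
    by move: ltS; rewrite (cardsD1 s) sS.
pose A := [pred z | connect r a z].
have AS z : A z -> z \notin S.
  case/connectP=> p; elim/last_ind: p => [_ ->//|p w _].
  by rewrite rcons_path last_rcons /r /= => /and3P[_ _ ?] ->.
pose B := [pred z | ~~ A z & z \notin S].
have noAB x y : A x -> B y -> ~~ e x y.
  move=> Ax /andP[nAy yS]; apply: contra nAy => exy.
  change (is_true (connect r a y)); apply: (connect_trans Ax); apply: connect1.
  by rewrite /r /= exy yS (AS x Ax).
have ls := links_le3 reg_e leP; have lt := links_le3 reg_e leQ.
have part x : 1 = A x + B x + Ps x + Pt x.
  rewrite -addnA -defS /B /=; have [/AS/negbTE->//|_ /=] := boolP (connect r a x).
  by case: (x \in S).
apply: (three_edge_connected_split ec_e part _ ls lt); first exact: links_eq0.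
  by exists a; apply: connect0.
by exists b; rewrite /B /= bS andbT.
Qed.

End EdgeConnectivity.

(** * Gluing two graphs along stubs *)

Section Glue.
Variables (O X : finType) (k : nat) (o : 'I_k -> O) (st : 'I_k -> X).

(** Stub [j] becomes the edge from [o j] to [st j]. The condition [simple_stubs] below makes the
    stub between two vertices unique, so that no parallel edges are lost. *)
Definition stub_at x i : option 'I_k := [pick j | (o j == x) && (st j == i)].

Definition glue (eO : rel O) (eX : rel X) : rel (O + X) := fun a b =>
  match a, b with
  | inl x, inl y => eO x y
  | inl x, inr i | inr i, inl x => isSome (stub_at x i)
  | inr i, inr j => eX i j
  end.

Definition glue_coloring (cO : O -> O -> color) (s : 'I_k -> color)
    (cX : X -> X -> color) : O + X -> O + X -> color := fun a b =>
  match a, b with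
  | inl x, inl y => cO x y
  | inl x, inr i | inr i, inl x => if stub_at x i is Some j then s j else Absent
  | inr i, inr j => cX i j
  end.

Lemma stub_at_None j x i : stub_at x i = None -> o j = x -> st j <> i.
Proof.
by rewrite /stub_at; case: pickP => // none _ oj /eqP stj; have:= none j; rewrite oj eqxx stj.
Qed.

Lemma stub_at_Some j x i : stub_at x i = Some j -> o j = x /\ st j = i.
Proof. by rewrite /stub_at; case: pickP => // j' /andP[/eqP<- /eqP<-] [<-]. Qed.

Definition simple_stubs := forall i j, o i = o j -> st i = st j -> i = j.

Hypothesis simple_o_st : simple_stubs.

(** Turns a test of the chosen stub into a sum over all stubs, in which at most one term is 1, so
    that double sums can be exchanged. *)
Lemma stub_atE (p : pred (option 'I_k)) x i : p None = false ->
  p (stub_at x i) = \sum_j [&& o j == x, st j == i & p (Some j)] :> nat.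
Proof.
move=> pN; case def_j: (stub_at x i) => [j|]; last first.
  rewrite pN big1 // => j _; have [oj|//] := eqVneq (o j) x.
  by have /eqP/negbTE-> := stub_at_None def_j oj.
have [oj stj] := stub_at_Some def_j.
rewrite (bigD1 j) //= oj stj !eqxx /= big1 ?addn0 // => j' /eqP neq_j.
have [oj'|//] := eqVneq (o j') x; have [stj'|//] := eqVneq (st j') i.
by case: neq_j; apply: simple_o_st; rewrite ?oj ?stj.
Qed.

Lemma sum_stub_at_X (p : pred (option 'I_k)) x : p None = false ->
  \sum_i p (stub_at x i) = \sum_j ((o j == x) && p (Some j)).
Proof.
move=> pN; under eq_bigr do rewrite stub_atE //.
rewrite exchange_big; apply: eq_bigr => j _ /=.
rewrite (bigD1 (st j)) //= eqxx big1 ?addn0 // => i /negbTE neq_i.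
by rewrite [st j == i]eq_sym neq_i andbF.
Qed.

Lemma sum_stub_at_O (p : pred (option 'I_k)) i : p None = false ->
  \sum_x p (stub_at x i) = \sum_j ((st j == i) && p (Some j)).
Proof.
move=> pN; under eq_bigr do rewrite stub_atE //.
rewrite exchange_big; apply: eq_bigr => j _ /=.
rewrite (bigD1 (o j)) //= eqxx big1 ?addn0 // => x /negbTE neq_x.
by rewrite [o j == x]eq_sym neq_x.
Qed.

Lemma sum_stubs (P : pred O) (Q : pred X) :
  \sum_x \sum_i [&& P x, Q i & isSome (stub_at x i)] =
  \sum_j (P (o j) && Q (st j)).
Proof.
have step x : \sum_i [&& P x, Q i & isSome (stub_at x i)] =
    \sum_j [&& o j == x, P x & Q (st j)].
  transitivity (\sum_i \sum_j [&& o j == x, st j == i, P x & Q i]).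
    apply: eq_bigr => i _.
    rewrite (@stub_atE (fun u => [&& P x, Q i & isSome u])) ?andbF //.
    by under eq_bigr do rewrite andbT.
  rewrite exchange_big; apply: eq_bigr => j _ /=.
  rewrite (bigD1 (st j)) //= eqxx big1 ?addn0 // => i /negbTE neq_i.
  by rewrite [st j == i]eq_sym neq_i andbF.
under eq_bigr do rewrite step.
rewrite exchange_big; apply: eq_bigr => j _ /=.
rewrite (bigD1 (o j)) //= eqxx big1 ?addn0 // => x /negbTE neq_x.
by rewrite [o j == x]eq_sym neq_x.
Qed.

Variables (eO : rel O) (eX : rel X).

Lemma glue_sym : symmetric eO -> symmetric eX -> symmetric (glue eO eX).
Proof. by move=> symO symX [x|i] [y|j] /=. Qed.

Lemma glue_irr : irreflexive eO -> irreflexive eX -> irreflexive (glue eO eX).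
Proof. by move=> irrO irrX [x|i] /=. Qed.

Lemma glue_three_regular : three_regular (glue eO eX) <->
  (forall x, \sum_y eO x y + \sum_j (o j == x) = 3) /\
  (forall i, \sum_j eX i j + \sum_j (st j == i) = 3).
Proof.
have degl x : \sum_b glue eO eX (inl x) b = \sum_y eO x y + \sum_j (o j == x).
  rewrite big_sumType /=; congr (_ + _); rewrite (@sum_stub_at_X isSome) //.
  by apply: eq_bigr => j _; rewrite andbT.
have degr i : \sum_b glue eO eX (inr i) b = \sum_j eX i j + \sum_j (st j == i).
  rewrite big_sumType /= addnC; congr (_ + _); rewrite (@sum_stub_at_O isSome) //.
  by apply: eq_bigr => j _; rewrite andbT.
split=> [reg|[regO regX] [x|i]]; last by rewrite degr.
  by split=> [x|i]; rewrite -?degl -?degr.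
by rewrite degl.
Qed.

Lemma glue_cut (A : pred (O + X)) : cut (glue eO eX) A =
  cut eO (A \o inl) + cut eX (A \o inr) + \sum_j (A (inl (o j)) != A (inr (st j))).
Proof.
rewrite /cut /links big_sumType /=.
under eq_bigr do rewrite big_sumType /=.
under [in X in _ + X]eq_bigr do rewrite big_sumType /=.
rewrite !big_split /= (sum_stubs (A \o inl) (predC (A \o inr))).
rewrite [X in _ + (X + _)]exchange_big /=.
have ->: \sum_x \sum_i [&& A (inr i), ~~ A (inl x) & isSome (stub_at x i)] =
    \sum_j (~~ A (inl (o j)) && A (inr (st j))).
  have /= <- := sum_stubs (predC (A \o inl)) (A \o inr).
  by apply: eq_bigr => x _; apply: eq_bigr => i _; rewrite andbCA.
have ->: \sum_(j < k) (A (inl (o j)) != A (inr (st j))) =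
    \sum_j (A (inl (o j)) && ~~ A (inr (st j))) +
    \sum_j (~~ A (inl (o j)) && A (inr (st j))).
  rewrite -big_split; apply: eq_bigr => j _ /=.
  by case: (A _) (A _) => [] [].
by rewrite [X in _ + X = _]addnC addnACA.
Qed.

End Glue.

(** * Colourings of glued graphs *)

Definition tree_of (V : finType) (c : V -> V -> color) : rel V :=
  fun x y => c x y == Tree.

(** Serves both sides, with [h] equal to [o] or [st]: a stub is a half-edge at its end. *)
Definition part_deg (Y : finType) (k : nat) (h : 'I_k -> Y) (s : 'I_k -> color)
    (c : Y -> Y -> color) (col : color) (y : Y) : nat :=
  \sum_z (c y z == col) + \sum_j ((h j == y) && (s j == col)).

(** The tree as seen from [X]: a detour through the outside becomes one step between the stubs by
    which it leaves and returns. [R] tells which outer ends are joined by tree edges outside. *)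
Definition linked (X : finType) (k : nat) (st : 'I_k -> X) (R : rel 'I_k)
    (s : 'I_k -> color) (cX : X -> X -> color) : rel X := fun i i' =>
  (cX i i' == Tree) || [exists j, exists j',
     [&& st j == i, st j' == i', s j == Tree, s j' == Tree & R j j']].

Section GlueColoring.
Variables (O X : finType) (k : nat) (o : 'I_k -> O) (st : 'I_k -> X).
Hypothesis simple_o_st : simple_stubs o st.
Variables (cO : O -> O -> color) (s : 'I_k -> color) (cX : X -> X -> color).

Local Notation c := (glue_coloring o st cO s cX).
Local Notation R := (fun j j' => connect (tree_of cO) (o j) (o j')).

Lemma glue_cdeg_inl col x : col != Absent ->
  cdeg c col (inl x) = part_deg o s cO col x.
Proof.
move=> col_ok; rewrite /cdeg /part_deg big_sumType /=; congr (_ + _).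
apply: (sum_stub_at_X simple_o_st
  (p := fun u => (if u is Some j then s j else Absent) == col)).
by rewrite eq_sym (negbTE col_ok).
Qed.

Lemma glue_cdeg_inr col i : col != Absent ->
  cdeg c col (inr i) = part_deg st s cX col i.
Proof.
move=> col_ok; rewrite /cdeg /part_deg big_sumType /= addnC; congr (_ + _).
apply: (sum_stub_at_O simple_o_st
  (p := fun u => (if u is Some j then s j else Absent) == col)).
by rewrite eq_sym (negbTE col_ok).
Qed.

Lemma glue_sum_Tree : \sum_a cdeg c Tree a =
  \sum_x \sum_y (cO x y == Tree) + \sum_j (s j == Tree) +
  \sum_i part_deg st s cX Tree i.
Proof.
rewrite big_sumType /=; congr (_ + _); last first.
  by apply: eq_bigr => i _; apply: glue_cdeg_inr.
under eq_bigr do rewrite glue_cdeg_inl //.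
rewrite big_split; congr (_ + _); rewrite exchange_big; apply: eq_bigr => j _ /=.
rewrite (bigD1 (o j)) //= eqxx big1 ?addn0 // => x /negbTE neq_x.
by rewrite [o j == x]eq_sym neq_x.
Qed.

Lemma tree_stub x i : ((if stub_at o st x i is Some j then s j else Absent) == Tree) =
  [exists j, [&& o j == x, st j == i & s j == Tree]].
Proof.
apply/idP/existsP=> [|[j /and3P[/eqP oj /eqP stj sj]]].
  case def_j: (stub_at _ _ _ _) => [j|//] sj.
  by have [oj stj] := stub_at_Some def_j; exists j; rewrite oj stj !eqxx.
case def_j: (stub_at _ _ _ _) => [j'|]; last by case: (stub_at_None def_j oj).
have [oj' stj'] := stub_at_Some def_j.
by rewrite (@simple_o_st j' j) ?oj' ?stj'.
Qed.

Hypotheses (sym_cO : forall x y, cO x y = cO y x) (sym_cX : forall i j, cX i j = cX j i).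

Lemma glue_coloring_sym a b : c a b = c b a.
Proof. by case: a b => [x|i] [y|j] /=. Qed.

(** An excursion of a tree path into [O] starts and ends with a tree stub, hence projects to a
    [linked] step. A tree path from [i0] to an outer vertex has to enter [O] by a tree stub. *)
Lemma glue_connected_sub (i0 : X) : all_connected (tree_of c) ->
  all_connected (linked st R s cX) /\
  forall x, exists2 j, s j = Tree & connect (tree_of cO) x (o j).
Proof.
move=> con_c.
have symO : symmetric (tree_of cO) by move=> x y; rewrite /tree_of sym_cO.
(* Invariant along the path: at an outer vertex, some tree stub is reachable on both sides. *)
have reach i a : connect (tree_of c) (inr i) a ->
    match a with
    | inl x => exists2 j, s j = Tree &
        connect (tree_of cO) x (o j) /\ connect (linked st R s cX) i (st j)
    | inr i' => connect (linked st R s cX) i i'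
    end.
  case/connectP=> p; elim/last_ind: p a => [|p b IHp] a /=.
    by move=> _ ->; apply: connect0.
  rewrite rcons_path last_rcons => /andP[ip tb] ->{a}; have := IHp _ ip erefl.
  case: (last _ p) b tb {ip} => [x|i1] [y|i2] /=; rewrite /tree_of /=.
  - move=> cxy [j sj [xj ij]]; exists j; rewrite // (sym_connect_sym symO) in xj *.
    by split; rewrite // (sym_connect_sym symO) (connect_trans xj) // connect1.
  - rewrite tree_stub => /existsP[j' /and3P[/eqP oj /eqP stj sj']] [j sj [xj ij]].
    apply: connect_trans ij _; rewrite -stj; apply: connect1; apply/orP; right.
    apply/existsP; exists j; apply/existsP; exists j'.
    by rewrite !eqxx sj sj' /= (sym_connect_sym symO) oj.
  - rewrite tree_stub => /existsP[j /and3P[/eqP oj /eqP stj /eqP sj]] ii1.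
    by exists j => //; rewrite oj stj.
  - by move=> c12 ii1; apply: connect_trans ii1 _; apply: connect1; rewrite /linked c12.
split=> [i i'|x]; first exact: (reach i (inr i')).
by have [j sj [xj _]] := reach i0 (inl x) (con_c _ _); exists j.
Qed.

Lemma glue_connected : all_connected (linked st R s cX) ->
  (forall x, exists2 j, s j = Tree & connect (tree_of cO) x (o j)) ->
  all_connected (tree_of c).
Proof.
move=> conX conO.
have symc : symmetric (tree_of c) by move=> a b; rewrite /tree_of glue_coloring_sym.
have liftO x y : connect (tree_of cO) x y -> connect (tree_of c) (inl x) (inl y).
  case/connectP=> p; elim: p x => [|z p IHp] x /=; first by move=> _ ->.
  case/andP=> txz tp def_y; apply: connect_trans (IHp z tp def_y).
  exact: connect1.
have stubT j : s j = Tree -> connect (tree_of c) (inl (o j)) (inr (st j)).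
  move=> sj; apply: connect1; rewrite /tree_of /= tree_stub.
  by apply/existsP; exists j; rewrite !eqxx sj.
have liftX i i' : connect (tree_of c) (inr i) (inr i').
  have /connectP[p] := conX i i'; elim: p i => [|i1 p IHp] i /=; first by move=> _ ->.
  case/andP=> lii1 lp def_i'; apply: connect_trans (IHp i1 lp def_i').
  case/orP: lii1 => [cii1|]; first exact: connect1.
  case/existsP=> j /existsP[j' /and5P[/eqP<- /eqP<- /eqP sj /eqP sj' Rjj']].
  apply: connect_trans (stubT _ sj'); apply: connect_trans (liftO _ _ Rjj').
  by rewrite (sym_connect_sym symc) stubT.
have toX i0 a : connect (tree_of c) a (inr i0).
  case: a => [x|i]; last exact: liftX.
  have [j sj xj] := conO x; apply: connect_trans (liftX (st j) i0).
  by apply: connect_trans (liftO _ _ xj) (stubT _ sj).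
move=> a b; case: (b) => [y|i]; last exact: toX.
have [j _ _] := conO y; apply: connect_trans (toX (st j) a) _.
by rewrite (sym_connect_sym symc).
Qed.

End GlueColoring.

(** Here [u] matching edges become tree edges. Only type (2,0,1) has one, and it turns into
    (3,0,0). *)
Lemma vertex_ok_upgrade u nT nC nM :
  vertex_ok nT nC (nM + u) -> vertex_ok (nT + u) nC nM.
Proof.
rewrite /vertex_ok !inE => /or3P[]/eqP[-> -> eq_u]; move: eq_u.
- by case: u nM => [|u] [|m].
- by case: u nM => [|[|u]] [|[|m]].
- by case: u nM => [|u] [|m].
Qed.

Section Recolor.
Variables (O X X' : finType) (k : nat).
Variables (o : 'I_k -> O) (st : 'I_k -> X) (st' : 'I_k -> X').
Hypotheses (simple_st : simple_stubs o st) (simple_st' : simple_stubs o st').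
Variables (cO : O -> O -> color) (s s' : 'I_k -> color).
Variables (cX : X -> X -> color) (cX' : X' -> X' -> color).

(** The share of the tree degree sum that depends on the gadget: a tree stub counts once at each of
    its two ends. *)
Definition total_tree_deg (Y : finType) (h : 'I_k -> Y) (r : 'I_k -> color)
    (c : Y -> Y -> color) :=
  \sum_j (r j == Tree) + \sum_i part_deg h r c Tree i.

(* A [Match] stub may be recoloured [Tree]: its outer end has degrees (2,0,1),
   which become (3,0,0). *)
Lemma recolor_decomposing (i0 : X') :
  decomposing (glue_coloring o st' cO s' cX') ->
  (forall j, s j = s' j \/ s' j = Match /\ s j = Tree) ->
  (forall i j, cX i j = cX j i) ->
  (forall i, vertex_ok (part_deg st s cX Tree i) (part_deg st s cX Cycle i)
                       (part_deg st s cX Match i)) ->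
  all_connected
    (linked st (fun j j' => connect (tree_of cO) (o j) (o j')) s cX) ->
  total_tree_deg st s cX + 2 * #|X'| = total_tree_deg st' s' cX' + 2 * #|X| ->
  decomposing (glue_coloring o st cO s cX).
Proof.
move=> [sym_c ok_c con_c count_c] up_s sym_cX okX conX totX.
have sym_cO x y : cO x y = cO y x by have := sym_c (inl x) (inl y).
have [_ conO] := glue_connected_sub simple_st' sym_cO i0 con_c.
have upT j : s' j = Tree -> s j = Tree by case: (up_s j) => [->|[->]].
split.
- exact: glue_coloring_sym.
- case=> [x|i]; last by rewrite !glue_cdeg_inr.
  rewrite !glue_cdeg_inl //; have := ok_c (inl x); rewrite !glue_cdeg_inl // /part_deg.
  (* The matching stubs at [x] that become tree stubs. *)
  pose u := \sum_j [&& o j == x, s' j == Match & s j == Tree].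
  have ->: \sum_j ((o j == x) && (s' j == Cycle)) = \sum_j ((o j == x) && (s j == Cycle)).
    by apply: eq_bigr => j _; case: (up_s j) => [->|[-> ->]].
  have ->: \sum_j ((o j == x) && (s' j == Match)) =
      \sum_j ((o j == x) && (s j == Match)) + u.
    rewrite -big_split; apply: eq_bigr => j _ /=; case: (o j == x) => //.
    by case: (up_s j) => [->|[-> ->]] //; case: (s' j).
  have ->: \sum_j ((o j == x) && (s j == Tree)) =
      \sum_j ((o j == x) && (s' j == Tree)) + u.
    rewrite -big_split; apply: eq_bigr => j _ /=; case: (o j == x) => //.
    by case: (up_s j) => [->|[-> ->]] //; case: (s' j).
  rewrite !addnA; exact: vertex_ok_upgrade.
- apply: glue_connected => // x.
  by have [j sj xj] := conO x; exists j; first exact: upT.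
(* The vertices of [O] and the tree edges inside [O] contribute equally to both counts and
   cancel. *)
- move: count_c totX; rewrite !glue_sum_Tree // /total_tree_deg !card_sum.
  lia.
Qed.

End Recolor.

(** * Gadgets and the reducibility check *)

(* The vertices are [0 .. top]; entry [j] of [gstubs] is the vertex to which stub [j]
   is attached.  A colouring of a gadget is a pair: the colours of the stubs, and the
   colours of [gedges] in the same order. *)
Record gadget := Gadget {top : nat; gedges : seq (nat * nat); gstubs : seq nat}.

Definition gvertex (g : gadget) := 'I_(top g).+1.
Definition gadj (g : gadget) : rel (gvertex g) := @graph_of (top g).+1 (gedges g).
Definition gstub (k : nat) (g : gadget) (j : 'I_k) : gvertex g :=
  inord (nth 0 (gstubs g) j).

Definition well_formed (k : nat) (g : gadget) : bool :=
  [&& all (fun p => [&& p.1 <= top g, p.2 <= top g & p.1 != p.2]) (gedges g),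
      all (fun v => v <= top g) (gstubs g) & size (gstubs g) == k].

Fixpoint edge_color (E : seq (nat * nat)) (cs : seq color) (i j : nat) : color :=
  match E, cs with
  | p :: E', c :: cs' =>
    if (p == (i, j)) || (p == (j, i)) then c else edge_color E' cs' i j
  | _, _ => Absent
  end.

(** This and the following definitions are computable counterparts of [part_deg], [total_tree_deg]
    and [linked], for [vm_compute]. In them [rho] encodes [R]: two stubs are related iff their
    entries agree. *)
Definition list_deg (k : nat) g (w : seq color * seq color) col (i : nat) : nat :=
  count (fun j => edge_color (gedges g) w.2 i j == col) (iota 0 (top g).+1) +
  count (fun j => (nth 0 (gstubs g) j == i) && (nth Absent w.1 j == col)) (iota 0 k).

Definition list_ok k g w : bool := all (fun i => vertex_ok (list_deg k g w Tree i)
  (list_deg k g w Cycle i) (list_deg k g w Match i)) (iota 0 (top g).+1).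

Definition list_total k g w : nat := count (fun j => nth Absent w.1 j == Tree) (iota 0 k) +
  sumn [seq list_deg k g w Tree i | i <- iota 0 (top g).+1].

Definition list_linked k g (rho : seq nat) (w : seq color * seq color) : rel nat :=
  fun i i' => (edge_color (gedges g) w.2 i i' == Tree) ||
  has (fun j => has (fun j' => [&& nth 0 (gstubs g) j == i, nth 0 (gstubs g) j' == i',
     nth Absent w.1 j == Tree, nth Absent w.1 j' == Tree & nth 0 rho j == nth 0 rho j'])
  (iota 0 k)) (iota 0 k).

(** A necessary condition for connectivity when there are at most two vertices, as in the
    replacement gadgets. *)
Definition pairwise_linked k g rho w : bool :=
  all (fun i => all (fun i' => (i == i') || list_linked k g rho w i i')
    (iota 0 (top g).+1)) (iota 0 (top g).+1).

Definition grow k g rho w (r : seq nat) : seq nat :=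
  [seq i <- iota 0 (top g).+1 | (i \in r) || has (fun i' => list_linked k g rho w i' i) r].

(** Search from vertex 0. Reaching all of [top g + 1] vertices takes at most [top g] rounds. *)
Definition list_connected k g rho w : bool :=
  let reached := iter (top g) (grow k g rho w) [:: 0] in
  all (fun i => i \in reached) (iota 0 (top g).+1).

Definition proper_colors n (cs : seq color) : bool :=
  (size cs == n) && all (fun c => c != Absent) cs.

Fixpoint color_words n : seq (seq color) :=
  if n is n'.+1 then
    [seq c :: w | c <- [:: Tree; Cycle; Match], w <- color_words n']
  else [:: [::]].

(* [rho] sends each stub to the least stub with an equivalent outer end. *)
Fixpoint stub_classes k : seq (seq nat) :=
  if k is k'.+1 then
    [seq rcons r a | r <- stub_classes k', a <- iota 0 k]
  else [:: [::]].

(* The [if]s keep call-by-value evaluation from exploring failed branches, which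
   [&&] and [==>] would not. *)
Definition recolors k g' g (rho : seq nat) (w' w : seq color * seq color) : bool :=
  if all (fun j => (nth Absent w.1 j == nth Absent w'.1 j) ||
           (nth Absent w'.1 j == Match) && (nth Absent w.1 j == Tree)) (iota 0 k)
  then if list_total k g w + 2 * (top g').+1 == list_total k g' w' + 2 * (top g).+1
  then [&& proper_colors (size (gedges g)) w.2, list_ok k g w & list_connected k g rho w]
  else false else false.

(** Necessary in a decomposition: an outside tree component without a tree stub would be cut off. *)
Definition meets_Tree k (rho : seq nat) (s : seq color) : bool :=
  all (fun j => has (fun j' => (nth Absent s j' == Tree) && (nth 0 rho j == nth 0 rho j'))
    (iota 0 k)) (iota 0 k).

(** For every colouring of [g'] and every pattern [rho] of outside connections that may come from a
    decomposition, some entry of [table] recolours [g]. The table only offers candidates, each of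
    which is verified. *)
Definition reducible k g' g (side : pred (seq nat)) table : bool :=
  all (fun s' => all (fun cs' =>
    if list_ok k g' (s', cs') then
      all (fun rho =>
        if [&& side rho, pairwise_linked k g' rho (s', cs') & meets_Tree k rho s']
        then has (recolors k g' g rho (s', cs')) table else true) (stub_classes k)
    else true)
    (color_words (size (gedges g')))) (color_words k).

Lemma mem_color_words n cs : proper_colors n cs -> cs \in color_words n.
Proof.
rewrite /proper_colors; elim: n cs => [|n IHn] [|c cs] //.
rewrite eqSS [all _ _]/= => /and3P[size_cs c_ok cs_ok].
apply/allpairsP; exists (c, cs); split=> //=; first by case: c c_ok.
by apply: IHn; rewrite size_cs.
Qed.

Lemma mem_stub_classes k rho : size rho = k -> (forall j, j < k -> nth 0 rho j <= j) ->
  rho \in stub_classes k.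
Proof.
elim: k rho => [|k IHk]; first by case.
elim/last_ind => // rho a _; rewrite size_rcons => -[size_rho] le_rho.
apply/allpairsP; exists (rho, a); split=> //=.
  apply: IHk => // j ltj; have := le_rho j (ltnW ltj).
  by rewrite nth_rcons size_rho ltj.
rewrite -[_ \in _]/(a \in iota 0 k.+1).
by have := le_rho k (leqnn _); rewrite nth_rcons size_rho ltnn eqxx mem_iota ltnS.
Qed.

Lemma sum_iota n (P : pred nat) : \sum_(i < n) P i = count P (iota 0 n).
Proof.
rewrite -(big_mkord predT (fun i => nat_of_bool (P i))) /index_iota subn0.
rewrite -sum1_count [RHS]big_mkcond /=.
by apply: eq_bigr => i _; case: (P i).
Qed.

Lemma edge_colorC E cs i j : edge_color E cs i j = edge_color E cs j i.
Proof. by elim: E cs => [|p E IHE] [|c cs] //=; rewrite IHE orbC. Qed.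

Lemma edge_color_Absent E cs i j : proper_colors (size E) cs ->
  (edge_color E cs i j != Absent) = ((i, j) \in E) || ((j, i) \in E).
Proof.
rewrite /proper_colors; elim: E cs => [|p E IHE] [|c cs] //=.
rewrite eqSS => /and3P[size_cs c_ok cs_ok]; rewrite !inE ![_ == p]eq_sym.
case: ifP => [/orP[]->|/norP[/negbTE-> /negbTE->]]; rewrite ?c_ok ?orbT //.
by rewrite IHE // size_cs.
Qed.

Lemma edge_color_map E (f : nat -> nat -> color) i j :
  (forall i j, f i j = f j i) ->
  edge_color E [seq f p.1 p.2 | p <- E] i j =
    if ((i, j) \in E) || ((j, i) \in E) then f i j else Absent.
Proof.
move=> symf; elim: E => //= p E ->; rewrite !inE ![_ == p]eq_sym orbACA.
by case: ifP => //= /orP[/eqP->|/eqP->] /=.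
Qed.

Section ListColorings.
Variables (k : nat) (g : gadget) (w : seq color * seq color).
Hypothesis wf_g : well_formed k g.

Definition stub_color (j : 'I_k) : color := nth Absent w.1 j.
Definition inner_color (i j : gvertex g) : color := edge_color (gedges g) w.2 i j.

Lemma gstub_val (j : 'I_k) : gstub g j = nth 0 (gstubs g) j :> nat.
Proof.
have /and3P[_ /allP leS /eqP sizeS] := wf_g.
by rewrite inordK // ltnS leS // mem_nth // sizeS.
Qed.

Lemma part_degE col (i : gvertex g) :
  part_deg (@gstub k g) stub_color inner_color col i = list_deg k g w col i.
Proof.
rewrite /part_deg /list_deg -!sum_iota; congr (_ + _).
by apply: eq_bigr => j _; rewrite -(inj_eq val_inj) /= gstub_val.
Qed.

Lemma total_tree_degE :
  total_tree_deg (@gstub k g) stub_color inner_color = list_total k g w.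
Proof.
rewrite /total_tree_deg /list_total -sum_iota; congr (_ + _).
rewrite sumnE big_map; have ->: iota 0 (top g).+1 = index_iota 0 (top g).+1 by [].
rewrite big_mkord.
by apply: eq_bigr => i _; apply: part_degE.
Qed.

Lemma linkedE (R : rel 'I_k) rho (i i' : gvertex g) :
  (forall j j' : 'I_k, (nth 0 rho j == nth 0 rho j') = R j j') ->
  linked (@gstub k g) R stub_color inner_color i i' = list_linked k g rho w i i'.
Proof.
move=> rhoR; congr (_ || _); apply/existsP/hasP=> [[j /existsP[j' jj']]|].
  exists (val j); first by rewrite mem_iota /=.
  apply/hasP; exists (val j'); first by rewrite mem_iota /=.
  by move: jj'; rewrite -rhoR -!(inj_eq val_inj) /= !gstub_val.
case=> j; rewrite mem_iota => /= ltj /hasP[j']; rewrite mem_iota => /= ltj' jj'.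
exists (Ordinal ltj); apply/existsP; exists (Ordinal ltj').
by rewrite -rhoR -!(inj_eq val_inj) /= !gstub_val.
Qed.

Lemma list_connectedP (R : rel 'I_k) rho :
  (forall j j' : 'I_k, (nth 0 rho j == nth 0 rho j') = R j j') ->
  symmetric R -> list_connected k g rho w ->
  all_connected (linked (@gstub k g) R stub_color inner_color).
Proof.
move=> rhoR symR /allP; set l := linked _ _ _ _; set step := grow _ _ _ _.
have syml : symmetric l.
  move=> i i'; rewrite /l /linked /inner_color edge_colorC; congr (_ || _).
  by apply/existsP/existsP=> -[j /existsP[j' /and5P[H1 H2 H3 H4 H5]]];
    exists j'; apply/existsP; exists j; rewrite symR; apply/and5P.
have reachP n : forall i, i \in iter n step [:: 0] ->
    exists2 v : gvertex g, val v = i & connect l ord0 v.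
  elim: n => [|n IHn] i /=; first by rewrite inE => /eqP->; exists ord0.
  rewrite mem_filter mem_iota => /andP[/orP[/IHn //|/hasP[i' /IHn[v <- lv] vi]]] /= lti.
  exists (Ordinal lti) => //; apply: connect_trans lv (connect1 _).
  by rewrite /l (linkedE _ _ rhoR).
move=> reach i i'.
have from0 (v : gvertex g) : connect l ord0 v.
  have /reach/reachP[v' /val_inj-> //] : val v \in iota 0 (top g).+1.
  by rewrite mem_iota /=.
by apply: connect_trans (from0 i'); rewrite (sym_connect_sym syml).
Qed.

Lemma pairwise_linkedP (R : rel 'I_k) rho : top g <= 1 ->
  (forall j j' : 'I_k, (nth 0 rho j == nth 0 rho j') = R j j') ->
  all_connected (linked (@gstub k g) R stub_color inner_color) ->
  pairwise_linked k g rho w.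
Proof.
move=> le1 rhoR con; apply/allP=> i; rewrite mem_iota add0n => lti.
apply/allP=> i'; rewrite mem_iota add0n => lti'; have [//|neq_i /=] := eqVneq i i'.
(* With at most two vertices, a step that leaves [i] arrives at [i']. *)
have [||u [v [_ /= /eqP-> nv]]] := @connect_crossing _ _ (pred1 (Ordinal lti))
    _ _ (con (Ordinal lti) (Ordinal lti')); rewrite /= ?eqxx //.
  by rewrite -(inj_eq val_inj) eq_sym.
rewrite (linkedE _ _ rhoR) /=; congr (list_linked _ _ _ _ _ _).
move: nv; rewrite -(inj_eq val_inj) /=; have := ltn_ord v.
by move: (val v) neq_i lti lti' le1 => n; rewrite /=; lia.
Qed.

End ListColorings.

(** The case of a single outer vertex: the stub colours are the colours at that vertex, all outer
    ends agree, whence [nseq k 0], and the whole graph has [top g + 2] vertices. *)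
Definition closes_up k g (w : seq color * seq color) : bool :=
  [&& vertex_ok (count (fun j => nth Absent w.1 j == Tree) (iota 0 k))
        (count (fun j => nth Absent w.1 j == Cycle) (iota 0 k))
        (count (fun j => nth Absent w.1 j == Match) (iota 0 k)),
      all (fun j => nth Absent w.1 j != Absent) (iota 0 k),
      proper_colors (size (gedges g)) w.2, list_ok k g w,
      list_connected k g (nseq k 0) w & list_total k g w + 2 == 2 * (top g).+2].

(** * Soundness of the reducibility check *)

Section Reduction.
Variables (O : finType) (eO : rel O) (k : nat) (o : 'I_k -> O).

Definition glued (g : gadget) : rel (O + gvertex g) := glue o (@gstub k g) eO (@gadj g).
Arguments glued : clear implicits.

Lemma glued_coloringE g w : well_formed k g -> proper_colors (size (gedges g)) w.2 ->
  (forall j : 'I_k, nth Absent w.1 j != Absent) ->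
  forall cO : O -> O -> color, (forall x y, eO x y = (cO x y != Absent)) ->
  forall a b, glued g a b =
    (glue_coloring o (@gstub k g) cO (stub_color w) (@inner_color g w) a b != Absent).
Proof.
move=> wf_g ok_w s_ok cO def_eO [x|i] [y|j] //=; last by rewrite edge_color_Absent.
  by case: stub_at => //= l; rewrite s_ok.
by case: stub_at => //= l; rewrite s_ok.
Qed.

Lemma iota_ordP (P : pred nat) : reflect (forall j : 'I_k, P j) (all P (iota 0 k)).
Proof.
apply: (iffP allP) => [allP j|allP j]; first by apply: allP; rewrite mem_iota /=.
by rewrite mem_iota => /= ltj; apply: (allP (Ordinal ltj)).
Qed.

(** The least stub related to [j], in accordance with [stub_classes]. *)
Definition class_index (R : rel 'I_k) (j : 'I_k) : nat :=
  find (fun i => R i j) (enum 'I_k).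

Lemma class_index_eq (R : rel 'I_k) : equivalence_rel R -> forall i j,
  (class_index R i == class_index R j) = R i j.
Proof.
move=> eqR i j; have Rr x : R x x by case: (eqR x x x).
have Rl x y z : R x y -> R x z = R y z by case: (eqR x y z).
have hasR x : has (fun i => R i x) (enum 'I_k).
  by apply/hasP; exists x; rewrite ?mem_enum.
have symR x y : R x y = R y x.
  by apply/idP/idP=> /Rl Rxy; rewrite -Rxy Rr.
apply/eqP/idP=> [eq_ij|Rij]; last first.
  by apply: eq_find => l; rewrite [R l i]symR [R l j]symR (Rl _ _ _ Rij).
have Ri := nth_find i (hasR i); have Rj := nth_find i (hasR j).
rewrite -/(class_index R i) eq_ij in Ri; by rewrite -(Rl _ _ _ Ri).
Qed.

Lemma class_index_le (R : rel 'I_k) j : R j j -> class_index R j <= j.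
Proof.
move=> Rjj; rewrite leqNgt; apply/negP=> lt_j.
by have := before_find j lt_j; rewrite nth_ord_enum Rjj.
Qed.

(** A decomposition after the exchange is read off as colour lists [w'] and a pattern [rho] of the
    outside tree; the check supplies [w], which is glued to the unchanged outside. [side] expresses
    what the shape of the outside imposes on [rho]. *)
Lemma reducible_decomposable g' g (side : pred (seq nat)) table :
  well_formed k g' -> well_formed k g -> top g' <= 1 ->
  simple_stubs o (@gstub k g') -> simple_stubs o (@gstub k g) ->
  (forall (t : rel O) rho, subrel t eO -> symmetric t ->
    (forall i j : 'I_k, (nth 0 rho i == nth 0 rho j) = connect t (o i) (o j)) ->
    side rho) ->
  reducible k g' g side table ->
  decomposable (glued g') -> decomposable (glued g).
Proof.
move=> wf' wf le_top simple' simple ok_side red [c def_c dec_c].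
have [sym_c ok_c con_c _] := dec_c.
pose cO x y := c (inl x) (inl y).
have def_eO x y : eO x y = (cO x y != Absent) by rewrite /cO -def_c.
pose s' := [seq c (inl (o j)) (inr (gstub g' j)) | j <- enum 'I_k].
have nth_s' (j : 'I_k) : nth Absent s' j = c (inl (o j)) (inr (gstub g' j)).
  by rewrite (nth_map j) ?size_enum_ord // nth_ord_enum.
pose f i j := c (inr (inord i : gvertex g')) (inr (inord j)).
have symf i j : f i j = f j i by rewrite /f sym_c.
pose cs' := [seq f p.1 p.2 | p <- gedges g'].
pose w' := (s', cs').
have inner' (i j : gvertex g') : inner_color w' i j = c (inr i) (inr j).
  rewrite /inner_color edge_color_map //.
  have := def_c (inr i) (inr j); rewrite /= /gadj /graph_of.
  by case: ifP => _; rewrite /f ?inord_val // => /eqP; rewrite eq_sym eqbF_neg negbK => /eqP.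
(* The given colouring is the gluing of its outer part, its stub colours and its inner colours. *)
have cE a b : c a b = glue_coloring o (@gstub k g') cO (stub_color w') (@inner_color g' w') a b.
  case: a b => [x|i] [y|j] //=.
    have := def_c (inl x) (inr j); rewrite /= /stub_color.
    case def_l: (stub_at _ _ _ _) => [l|]; last by move/esym/negbFE/eqP.
    by have [<- <-] := stub_at_Some def_l; rewrite nth_s'.
  rewrite sym_c; have := def_c (inl y) (inr i); rewrite /= /stub_color.
  case def_l: (stub_at _ _ _ _) => [l|]; last by move/esym/negbFE/eqP.
  by have [<- <-] := stub_at_Some def_l; rewrite nth_s'.
have {}dec_c : decomposing
    (glue_coloring o (@gstub k g') cO (stub_color w') (@inner_color g' w')).
  apply: (decomposing_bij (f := id)) dec_c; first by exists id.
  by move=> a b; rewrite cE.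
have s'_ok (j : 'I_k) : nth Absent s' j != Absent.
  rewrite nth_s' -def_c /=; case def_l: (stub_at _ _ _ _) => [//|].
  by have := stub_at_None def_l erefl.
have sym_cO x y : cO x y = cO y x by rewrite /cO sym_c.
have symT : symmetric (tree_of cO) by move=> x y; rewrite /tree_of sym_cO.
pose R : rel 'I_k := fun i j => connect (tree_of cO) (o i) (o j).
have eqR : equivalence_rel R.
  move=> x y z; rewrite /R connect0; split=> // Rxy.
  by apply: same_connect => //; apply: sym_connect_sym.
pose rho := [seq class_index R j | j <- enum 'I_k].
have rhoE (j : 'I_k) : nth 0 rho j = class_index R j.
  by rewrite (nth_map j) ?size_enum_ord // nth_ord_enum.
have rhoR (i j : 'I_k) : (nth 0 rho i == nth 0 rho j) = R i j.
  by rewrite !rhoE class_index_eq.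
have [conX conO] := glue_connected_sub simple' sym_cO (ord0 : gvertex g')
  (let: And4 _ _ con _ := dec_c in con).
have s'_word : s' \in color_words k.
  apply: mem_color_words; rewrite /proper_colors size_map size_enum_ord eqxx.
  by apply/allP=> _ /mapP[j _ ->]; rewrite -nth_s' s'_ok.
have cs'_word : cs' \in color_words (size (gedges g')).
  apply: mem_color_words; rewrite /proper_colors size_map eqxx.
  apply/allP=> _ /mapP[[i j] ij ->] /=; rewrite /f -def_c /= /gadj /graph_of.
  have /and3P[/allP/(_ _ ij)/and3P[/= lei lej _] _ _] := wf'.
  by rewrite !inordK ?ij.
have ok_w' : list_ok k g' w'.
  apply/allP=> i; rewrite mem_iota => /= lti.
  have [_ okG _ _] := dec_c; have := okG (inr (Ordinal lti)).
  by rewrite !glue_cdeg_inr // !part_degE.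
have rho_class : rho \in stub_classes k.
  apply: mem_stub_classes; first by rewrite size_map size_enum_ord.
  by move=> j ltj; rewrite (rhoE (Ordinal ltj)) class_index_le // /R connect0.
have side_rho : side rho.
  apply: (ok_side (tree_of cO)) => // x y; rewrite /tree_of def_eO.
  by move/eqP->.
have pair_rho : pairwise_linked k g' rho w' by apply: pairwise_linkedP conX.
have meets_rho : meets_Tree k rho s'.
  apply/iota_ordP=> j; have [j' sj' jj'] := conO (o j).
  apply/hasP; exists (val j'); first by rewrite mem_iota /=.
  by rewrite rhoR /R jj' andbT; apply/eqP.
move/allP/(_ _ s'_word)/allP/(_ _ cs'_word): red; rewrite ok_w'.
move/allP/(_ _ rho_class); rewrite side_rho pair_rho meets_rho /=.
case/hasP=> w _; rewrite /recolors.
case: ifP => // /iota_ordP up_s; case: ifP => // /eqP tot_w /and3P[proper_w ok_w con_w].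
have up (j : 'I_k) : stub_color w j = stub_color w' j \/
    stub_color w' j = Match /\ stub_color w j = Tree.
  by case/orP: (up_s j) => [/eqP|/andP[/eqP ? /eqP ?]]; [left | right].
exists (glue_coloring o (@gstub k g) cO (stub_color w) (@inner_color g w)).
  apply: glued_coloringE => // j.
  by case: (up j) => [|[_]]; rewrite /stub_color => ->.
apply: (recolor_decomposing simple simple' (ord0 : gvertex g') dec_c) => //.
- by move=> i j; apply: edge_colorC.
- by move=> i; rewrite !part_degE //; apply: (allP ok_w); rewrite mem_iota /=.
- apply: list_connectedP con_w => //.
  by move=> i j; rewrite (sym_connect_sym symT).
- by rewrite !total_tree_degE // !card_ord.
Qed.

(** Used when three stubs share one outer vertex, so that an exchange for a vertex would give
    parallel edges; the whole graph is coloured directly. *)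
Lemma closes_up_decomposable g w (x0 : O) : well_formed k g ->
  simple_stubs o (@gstub k g) -> irreflexive eO -> (forall x y : O, x = y) ->
  closes_up k g w -> decomposable (glued g).
Proof.
move=> wf simple irr_eO allO /and5P[ok_s /iota_ordP s_ok proper_w ok_w /andP[con_w /eqP tot_w]].
pose cO := fun _ _ : O => Absent.
have oE j x : (o j == x) = true by apply/eqP.
exists (glue_coloring o (@gstub k g) cO (stub_color w) (@inner_color g w)).
  by apply: glued_coloringE => // x y; rewrite (allO x y) irr_eO.
split.
- by apply: glue_coloring_sym => // i j; apply: edge_colorC.
- case=> [x|i]; last first.
    rewrite !glue_cdeg_inr // !part_degE //.
    by apply: (allP ok_w); rewrite mem_iota /=; apply: ltn_ord.
  rewrite !glue_cdeg_inl // /part_deg.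
  have sumE col : col != Absent -> \sum_z (cO x z == col) +
      \sum_j ((o j == x) && (stub_color w j == col)) =
      count (fun j => nth Absent w.1 j == col) (iota 0 k).
    move=> col_ok; rewrite big1 => [|z _]; last by rewrite eq_sym (negbTE col_ok).
    by rewrite add0n -sum_iota; apply: eq_bigr => j _; rewrite oE.
  by rewrite !sumE.
- apply: glue_connected => //; first by move=> i j; apply: edge_colorC.
    apply: list_connectedP con_w => // i j; last by rewrite (allO (o i) (o j)).
    by rewrite !nth_nseq !ltn_ord eqxx (allO (o i) (o j)) connect0.
  move=> x; have: 0 < count (fun j => nth Absent w.1 j == Tree) (iota 0 k).
    by move: ok_s; rewrite /vertex_ok !inE => /or3P[]/eqP[->].
  rewrite -has_count => /hasP[j]; rewrite mem_iota => /= ltj /eqP sj.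
  by exists (Ordinal ltj) => //; rewrite (allO x (o (Ordinal ltj))) connect0.
- rewrite glue_sum_Tree // big1 => [|x _]; last by apply: big1.
  rewrite -[X in X + _ = _]/(total_tree_deg _ _ _).
  rewrite total_tree_degE // tot_w card_sum card_ord.
  suff ->: #|O| = 1 by lia.
  by apply/eqP/fintype1P; exists x0 => y; apply: allO.
Qed.

End Reduction.

Arguments glued {O} eO {k} o g.

(** * Locating a gadget in a cubic graph *)

Definition cubic_gadget k g : bool :=
  all (fun i =>
    count (fun j => ((i, j) \in gedges g) || ((j, i) \in gedges g)) (iota 0 (top g).+1) +
    count (fun j => nth 0 (gstubs g) j == i) (iota 0 k) == 3) (iota 0 (top g).+1).

Section Occurrence.
Variables (T : finType) (e : rel T) (k : nat) (g : gadget) (f : gvertex g -> T).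
Hypotheses (sym_e : symmetric e) (irr_e : irreflexive e) (cub_e : cubic e).
Hypotheses (wf_g : well_formed k g) (cub_g : cubic_gadget k g) (Ug : uniq (gstubs g)).
Hypotheses (inj_f : injective f) (hom_f : forall i j, gadj i j -> e (f i) (f j)).

Local Notation st := (@gstub k g).

Lemma gstub_inj : injective st.
Proof.
have /and3P[_ _ /eqP sizeS] := wf_g.
move=> i j eq_ij; apply/val_inj/eqP; rewrite -(nth_uniq 0 _ _ Ug) ?sizeS ?ltn_ord //.
by rewrite -(gstub_val wf_g) eq_ij (gstub_val wf_g).
Qed.

Lemma gadget_deg (i : gvertex g) : \sum_j gadj i j + \sum_j (st j == i) = 3.
Proof.
have /allP/(_ (val i)) := cub_g; rewrite mem_iota ltn_ord => /(_ isT)/eqP <-.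
rewrite -!sum_iota; congr (_ + _); apply: eq_bigr => j _.
by rewrite -(inj_eq val_inj) /= (gstub_val wf_g).
Qed.

Let inner_nbrs i : {set T} := [set f j | j in [set j | gadj i j]].
Let nbrs x : {set T} := [set y | e x y].

Lemma sub_inner_nbrs i : inner_nbrs i \subset nbrs (f i).
Proof. by apply/subsetP=> _ /imsetP[j + ->]; rewrite !inE => /hom_f. Qed.

Lemma card_inner_nbrs i : #|inner_nbrs i| + \sum_j (st j == i) = 3.
Proof. by rewrite card_imset // -sum_card gadget_deg. Qed.

(** By degree, a stub vertex has exactly one neighbour apart from the images of its gadget
    neighbours, and any other vertex none. Since the occurrence may fail to be induced, [y j] may
    lie in the image of [f]. *)
Lemma outer_nbrs : exists y : 'I_k -> T,
  (forall j, y j \notin inner_nbrs (st j)) /\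
  (forall i z, e (f i) z = (z \in inner_nbrs i) || [exists j, (st j == i) && (y j == z)]).
Proof.
have one j : exists z, nbrs (f (st j)) :\: inner_nbrs (st j) == [set z].
  suff /cards1P[z ->]: #|nbrs (f (st j)) :\: inner_nbrs (st j)| == 1 by exists z.
  rewrite cardsD (setIidPr (sub_inner_nbrs _)) cub_e.
  have := card_inner_nbrs (st j); rewrite (bigD1 j) //= eqxx big1 ?addn0; first by lia.
  by move=> j' neq_j; rewrite (inj_eq gstub_inj) (negbTE neq_j).
pose y j := xchoose (one j); have yP j := eqP (xchooseP (one j)).
have yD j z : (z \in nbrs (f (st j)) :\: inner_nbrs (st j)) = (z == y j).
  by rewrite yP inE.
exists y; split=> [j|i z].
  by have: y j == y j by []; rewrite -yD inE => /andP[].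
have [/existsP[j /eqP def_i]|no_st] := boolP [exists j, st j == i].
  have -> : [exists j', (st j' == i) && (y j' == z)] = (z == y j).
    apply/existsP/eqP=> [[j' /andP[/eqP eq_i /eqP <-]]|->].
      by congr y; apply: gstub_inj; rewrite eq_i.
    by exists j; rewrite def_i !eqxx.
  rewrite -yD def_i inE inE; case zi: (z \in _) => //=.
  by have := subsetP (sub_inner_nbrs i) z zi; rewrite inE.
have -> : [exists j, (st j == i) && (y j == z)] = false.
  apply: contraNF no_st => /existsP[j /andP[stj _]]; by apply/existsP; exists j.
rewrite orbF; have := sub_inner_nbrs i; rewrite subEproper => /orP[/eqP->|].
  by rewrite inE.
move/proper_card; rewrite cub_e; have := card_inner_nbrs i.
rewrite big1 ?addn0 => [|j _]; first by move=> ->.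
by apply/eqP; rewrite eqb0; apply: contra no_st => stj; apply/existsP; exists j.
Qed.

Definition glued_model := exists (O : finType) (eO : rel O) (o : 'I_k -> O)
    (h : O + gvertex g -> T),
  [/\ bijective h, simple_stubs o st
    & forall a b, e (h a) (h b) = glued eO o g a b].

(* One chord between stub vertices leaves fewer than 3 edges out of the gadget, so
   that the gadget covers the whole graph and every stub is half of a chord. *)
Lemma glued_model_or_chords : three_edge_connected e -> k <= 4 ->
  glued_model \/ exists p : 'I_k -> 'I_k, forall j,
    [/\ p j != j, p (p j) = j, e (f (st j)) (f (st (p j))) & ~~ gadj (st j) (st (p j))].
Proof.
move=> ec_e le_k; have [y [y_out def_e]] := outer_nbrs.
have st_y j : e (f (st j)) (y j).
  by rewrite def_e; apply/orP; right; apply/existsP; exists j; rewrite !eqxx.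
(* An edge from a stub back into the image is not a gadget edge, so it is also the stub of its other
   end: chords pair up stubs. *)
have chordP j i : y j = f i -> exists2 j', st j' = i & y j' = f (st j).
  move=> yj; have := st_y j; rewrite yj sym_e def_e => /orP[|/existsP[j' /andP[/eqP ? /eqP ?]]].
    case/imsetP=> i'; rewrite inE => ii' /inj_f def_i'; case/negP: (y_out j).
    by rewrite yj; apply/imsetP; exists i => //; rewrite inE /gadj /graph_of orbC def_i'.
  by exists j'.
have [/existsP[j0 /codomP[i0 yj0]]|no_chord] := boolP [exists j, y j \in codom f].
  right; have [j1 st1 yj1] := chordP _ _ yj0.
  have neq01 : j1 != j0.
    apply: contraTneq (st_y j0) => eq_j; rewrite yj0 -st1 eq_j irr_e //.
  (* Every edge that leaves the image belongs to a stub that is not half of a chord. *)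
  have cut_le : cut e [pred x | x \in codom f] <= \sum_j (y j \notin codom f).
    have leq_out i z : [&& f i \in codom f, z \notin codom f & e (f i) z] <=
        \sum_j [&& st j == i, y j == z & y j \notin codom f].
      rewrite def_e codom_f /=; case: (boolP (z \in codom f)) => //= zf.
      case: (boolP (z \in _)) => [/imsetP[i' _ def_z]|_] /=.
        by rewrite def_z codom_f in zf.
      case: existsP => // -[j /andP[/eqP stj /eqP yj]].
      by rewrite (bigD1 j) //= stj yj !eqxx zf.
    rewrite /cut /links (bigID [pred x | x \in codom f]) /= [X in _ + X]big1 ?addn0.
      have Uf : uniq (codom f) by rewrite map_inj_uniq ?enum_uniq.
      rewrite -(big_uniq _ Uf) big_map big_enum /=.
      apply: (@leq_trans (\sum_i \sum_z \sum_j [&& st j == i, y j == z & y j \notin codom f])).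
        by apply: leq_sum => i _; apply: leq_sum => z _; apply: leq_out.
      under eq_bigr do rewrite exchange_big.
      rewrite exchange_big leq_sum // => j _ /=; rewrite (bigD1 (st j)) //= eqxx.
      rewrite (bigD1 (y j)) //= eqxx /= !big1 ?addn0 // => [i /negbTE neq_i|z /negbTE neq_z].
        by rewrite big1 // => z _; rewrite [st j == i]eq_sym neq_i.
      by rewrite [y j == z]eq_sym neq_z.
    by move=> x /negbTE xf; apply: big1 => z _; rewrite xf.
  have allf z : z \in codom f.
    apply/negPn/negP=> zf; have := leq_trans (ec_e _ _ _) cut_le; rewrite leqNgt.
    case/(_ _ _)/negP=> //.
    - by exists (f ord0); rewrite /= codom_f.
    - by exists z.
    have tot : \sum_j (y j \notin codom f) + \sum_j (y j \in codom f) = k.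
      rewrite -big_split /= -[RHS]card_ord -sum1_card; apply: eq_bigr => j _.
      by case: (_ \in _).
    (* A chord takes up two stubs, so at most two of at most four are left. *)
    have : 2 <= \sum_j (y j \in codom f).
      by rewrite (bigD1 j0) //= (bigD1 j1) //= yj0 yj1 !codom_f.
    by move: tot le_k; lia.
  (* The default never occurs: by [allf] and [chordP] every [y j] is a stub vertex. *)
  pose p j := odflt j [pick j' | y j == f (st j')].
  have pP j : y j = f (st (p j)).
    rewrite /p; case: pickP => [j' /eqP //|none].
    have /codomP[i yj] := allf (y j); have [j' stj' _] := chordP _ _ yj.
    by have := none j'; rewrite yj stj' eqxx.
  exists p => j; split.
  - apply: contraTneq (st_y j) => pj; by rewrite pP pj irr_e.
  - have [j' /gstub_inj-> ] := chordP _ _ (pP j).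
    by rewrite pP => /inj_f/gstub_inj.
  - by rewrite -pP.
  - apply: contra (y_out j) => adj_j; rewrite pP; apply/imsetP.
    by exists (st (p j)); rewrite ?inE.
left; exists {x : T | x \notin codom f}, (fun x y => e (val x) (val y)).
have out j : y j \notin codom f by apply: contra no_chord => yj; apply/existsP; exists j.
pose o j : {x : T | x \notin codom f} := Sub (y j) (out j).
exists o, (fun a => match a with inl x => val x | inr i => f i end); split.
- apply: inj_card_bij.
    move=> [x|i] [z|j] //= => [/val_inj-> //|eq_x|eq_z|/inj_f-> //].
      by case/negP: (valP x); apply/codomP; exists j.
    by case/negP: (valP z); apply/codomP; exists i.
  rewrite card_sum card_sig -(card_codom inj_f) -(cardC (mem (codom f))) addnC.
  by rewrite leq_add2l; apply: subset_leq_card; apply/subsetP.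
- by move=> i j _ /gstub_inj.
have eS (x : {x : T | x \notin codom f}) i : e (f i) (val x) = isSome (stub_at o st x i).
  have -> : isSome (stub_at o st x i) = [exists j, (st j == i) && (o j == x)].
    rewrite /stub_at; case: pickP => /= [j|none]; last first.
      by apply/esym/existsP=> -[j]; rewrite andbC none.
    by move=> oj; apply/esym/existsP; exists j; rewrite andbC.
  rewrite def_e; have -> : (val x \in inner_nbrs i) = false.
    by apply: contraNF (valP x) => /imsetP[j _ ->]; apply: codom_f.
  by apply: eq_existsb => j; rewrite -(inj_eq val_inj).
move=> [x|i] [z|j] //=; [by rewrite sym_e eS | by rewrite eS |].
rewrite def_e; have -> : [exists j0, (st j0 == i) && (y j0 == f j)] = false.
  apply/existsP=> -[j0 /andP[_ /eqP yj0]]; case/negP: (out j0).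
  by rewrite yj0 codom_f.
by rewrite orbF mem_imset // inE.
Qed.

End Occurrence.

(** * Exchanging gadgets preserves 3-edge-connectivity *)

(* What a bridge between the outer ends of stubs 0, 1 and those of stubs 2, 3 imposes
   on [rho]: tree paths from 0 to 2 and from 1 to 3 share it. *)
Definition domino_side : pred (seq nat) := fun rho =>
  (nth 0 rho 0 == nth 0 rho 2) && (nth 0 rho 1 == nth 0 rho 3) ==>
  (nth 0 rho 0 == nth 0 rho 1).

Definition vertex_gadget := Gadget 0 [::] [:: 0; 0; 0].
Definition edge_gadget st := Gadget 1 [:: (0, 1)] st.

Section Outside.
Variables (O : finType) (eO : rel O) (k : nat) (o : 'I_k -> O).
Hypotheses (sym_eO : symmetric eO) (irr_eO : irreflexive eO).

(** What 3-edge-connectivity of the glued graph says about sets that avoid the gadget. Only the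
    outer ends of the stubs enter, so this survives the exchange, as does [outside_regular]. *)
Definition outside_connected := forall A : pred O, (exists x, A x) ->
  3 <= cut eO A + \sum_j A (o j).

Definition outside_regular := forall x, \sum_y eO x y + \sum_j (o j == x) = 3.

Lemma gadj_sym g : symmetric (@gadj g).
Proof. by move=> i j; rewrite /gadj /graph_of orbC. Qed.

Lemma gadj_irr g : well_formed k g -> irreflexive (@gadj g).
Proof.
move=> /and3P[/allP okE _ _] i; rewrite /gadj /graph_of orbb.
by apply/negP=> /okE/and3P[_ _]; rewrite eqxx.
Qed.

Lemma glued_sym g : symmetric (glued eO o g).
Proof. exact/glue_sym/gadj_sym. Qed.

Lemma glued_irr g : well_formed k g -> irreflexive (glued eO o g).
Proof. by move=> wf; apply/glue_irr/gadj_irr. Qed.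

Lemma glued_outside_connected g : simple_stubs o (@gstub k g) ->
  three_edge_connected (glued eO o g) -> outside_connected.
Proof.
move=> simple ec A [x Ax].
pose A' (a : O + gvertex g) := if a is inl y then A y else false.
have := ec A' (ex_intro _ (inl x) Ax) (ex_intro _ (inr ord0) isT).
rewrite glue_cut // [X in _ + X + _](_ : _ = 0) ?addn0; last by apply: links_eq0.
by congr (_ <= _ + _); apply: eq_bigr => j _ /=; case: (A _).
Qed.

Lemma glued_outside_regular g : simple_stubs o (@gstub k g) ->
  three_regular (glued eO o g) -> outside_regular.
Proof. by move=> simple /(glue_three_regular simple)[]. Qed.

Lemma glued_regular g : outside_regular -> well_formed k g -> cubic_gadget k g ->
  simple_stubs o (@gstub k g) -> three_regular (glued eO o g).
Proof.
move=> reg wf cub simple; apply/(glue_three_regular simple); split=> // i.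
exact: gadget_deg.
Qed.

Lemma cut_pred1_le w : cut eO (pred1 w) <= \sum_y eO w y.
Proof.
rewrite /cut /links (bigD1 w) //= eqxx [X in _ + X]big1 ?addn0.
  by apply: leq_sum => y _; case: (y == w).
by move=> x /negbTE neq_x; apply: big1 => y _; rewrite neq_x.
Qed.

Hypotheses (con_o : outside_connected) (reg_o : outside_regular).

Lemma outside_connectedC (A : pred O) : (exists x, ~~ A x) ->
  3 <= cut eO A + \sum_j ~~ A (o j).
Proof. by rewrite -(cutC sym_eO) => nA; apply: con_o. Qed.

(** If [m >= 2] stubs end at [w], then at most [3 - m] outside edges at [w] and [3 - m] further
    stubs lead to the remaining outer vertices: at most two edges in all, so there are no such
    vertices. *)
Lemma three_stubs_inj : k = 3 -> injective o \/ forall x y : O, x = y.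
Proof.
move=> k3; have [/injectiveP|/injectivePn[i [j neq_ij eq_o]]] := boolP (injectiveb o).
  by left.
right; suff allw x : x = o i by move=> x y; rewrite (allw x) (allw y).
apply/eqP/negPn/negP=> neq_x.
have := @outside_connectedC (pred1 (o i)) (ex_intro _ x neq_x).
have := cut_pred1_le (o i); have := reg_o (o i).
have : \sum_l (o l == o i) + \sum_l ~~ (o l == o i) = k.
  rewrite -big_split -[RHS]card_ord -sum1_card; apply: eq_bigr => l _ /=.
  by case: (_ == _).
have : 2 <= \sum_l (o l == o i).
  by rewrite (bigD1 i) //= (bigD1 j) 1?eq_sym //= eq_o !eqxx.
rewrite /=; lia.
Qed.

Lemma glued_vertex_connected : simple_stubs o (@gstub k vertex_gadget) ->
  three_edge_connected (glued eO o vertex_gadget).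
Proof.
move=> simple A exA exnA.
have allord (i : gvertex vertex_gadget) : i = ord0 by apply: ord1.
(* Up to complement the new vertex lies outside [A], and [outside_connected] applies. *)
wlog A0 : A exA exnA / ~~ A (inr ord0).
  move=> wl; case A0: (A (inr ord0)); last by apply: wl; rewrite ?A0.
  rewrite -cutC; last exact: glued_sym.
  apply: wl; rewrite /= ?A0 //.
  by have [x Ax] := exA; exists x; rewrite /= Ax.
have nA i : A (inr i) = false by rewrite (allord i) (negbTE A0).
have [x Ax] : exists x, A (inl x).
  by have [[x|i] Ai] := exA; [exists x | rewrite nA in Ai].
apply: leq_trans (con_o (ex_intro (A \o inl) x Ax)) _.
rewrite glue_cut // -addnA leq_add2l (leq_trans _ (leq_addl _ _)) //.
by apply: leq_sum => j _ /=; rewrite nA; case: (A _).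
Qed.

End Outside.

Lemma submodular_cut (V : finType) (e : rel V) (A B : pred V) :
  cut e [pred x | A x && B x] + cut e [pred x | A x || B x] <= cut e A + cut e B.
Proof.
rewrite /cut /links -!big_split leq_sum // => x _ /=.
rewrite -!big_split leq_sum // => y _ /=.
by case: (A x); case: (B x); case: (A y); case: (B y); case: (e x y).
Qed.

(** * Pairings of four stubs *)

Section Pairings.
Variables (O : finType) (eO : rel O) (o : 'I_4 -> O).
Hypotheses (sym_eO : symmetric eO) (irr_eO : irreflexive eO).
Hypotheses (con_o : outside_connected eO o) (reg_o : outside_regular eO o).

(** [q] marks the stubs at one end of the new edge. A set that separates its ends cuts the new edge
    and must cut two more: outside edges, or stubs, which are the mismatches with [q]. *)
Definition good_pairing (q : pred 'I_4) :=
  forall A : pred O, 2 <= cut eO A + \sum_j (A (o j) != q j).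

(** If [cut eO A] were 0, connectivity for [A] and for its complement would require three of the
    four stubs on either side. So the cut is 1, which leaves no mismatch. *)
Lemma bad_pairing (q : pred 'I_4) A :
  \sum_j q j = 2 -> cut eO A + \sum_j (A (o j) != q j) <= 1 ->
  cut eO A = 1 /\ forall j, A (o j) = q j.
Proof.
move=> sumq bad.
have mism : \sum_j A (o j) <= \sum_j q j + \sum_j (A (o j) != q j).
  rewrite -big_split leq_sum // => j _ /=; by case: (A _) (q _) => [] [].
have mismC : \sum_j q j <= \sum_j A (o j) + \sum_j (A (o j) != q j).
  rewrite -big_split leq_sum // => j _ /=; by case: (A _) (q _) => [] [].
have sumC : \sum_j A (o j) + \sum_j ~~ A (o j) = 4.
  rewrite -big_split -[RHS]card_ord -sum1_card; apply: eq_bigr => j _ /=.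
  by case: (A _).
have ex (P : pred O) : 0 < \sum_j P (o j) -> exists x, P x.
  rewrite lt0n sum_nat_eq0 negb_forall => /existsP[j]; rewrite eqb0 negbK => Pj.
  by exists (o j).
have leA : 3 <= cut eO A + \sum_j A (o j) by apply/con_o/ex; lia.
have leAC : 3 <= cut eO A + \sum_j ~~ A (o j).
  by apply: outside_connectedC => //; apply: (ex (predC A));
    rewrite [X in _ < X](_ : _ = \sum_j ~~ A (o j)) //; lia.
have [cut1 mism0] : cut eO A = 1 /\ \sum_j (A (o j) != q j) = 0.
  by lia.
split=> // j; move/eqP: mism0; rewrite sum_nat_eq0 => /forallP/(_ j).
by rewrite eqb0 negbK => /eqP.
Qed.

(** Otherwise let [w] be the common outer end, and [m] the number of stubs there. The set of [w]
    alone cuts at most [3 - m] outside edges and has at most [m - 2] mismatches, one in all. *)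
Lemma good_pairing_simple_stubs (q : pred 'I_4) i j : \sum_l q l = 2 -> good_pairing q ->
  o i = o j -> q i = q j -> i = j.
Proof.
move=> sumq good eq_o eq_q; apply/eqP/negPn/negP=> neq_ij.
(* Up to complement, [i] and [j] are marked. *)
have {sumq good} [q' [q'i q'j sumq' good]] : exists q' : pred 'I_4,
    [/\ q' i, q' j, \sum_l q' l = 2 & good_pairing q'].
  case qi: (q i); first by exists q; rewrite -eq_q qi.
  exists (predC q); rewrite /= -eq_q qi; split=> // [|A].
    have : \sum_l q l + \sum_l ~~ q l = 4.
      rewrite -big_split -[RHS]card_ord -sum1_card; apply: eq_bigr => l _ /=.
      by case: (q l).
    by rewrite sumq => /(@addnI 2 _ 2).
  rewrite -(cutC sym_eO); apply: leq_trans (good (predC A)) _.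
  by rewrite leq_add2l leq_sum // => l _ /=; case: (A _) (q l) => [] [].
have := good (pred1 (o i)); have := cut_pred1_le eO (o i); have := reg_o (o i).
have : \sum_l ((o l == o i) != q' l) + 2 * \sum_l ((o l == o i) && q' l) =
    \sum_l (o l == o i) + \sum_l q' l.
  rewrite mul2n -addnn -!big_split; apply: eq_bigr => l _ /=.
  by case: (_ == _) (q' l) => [] [].
have : 2 <= \sum_l ((o l == o i) && q' l).
  by rewrite (bigD1 i) //= (bigD1 j) 1?eq_sym //= -eq_o !eqxx q'i q'j.
rewrite sumq' /=; lia.
Qed.

(** A set that separates the ends of the new edge cuts it, and [good_pairing] provides two more
    edges. Otherwise the gadget lies on one side and [outside_connected] applies. *)
Lemma glued_edge_connected sts : well_formed 4 (edge_gadget sts) ->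
  good_pairing (fun j => gstub (edge_gadget sts) j == ord0) ->
  simple_stubs o (@gstub 4 (edge_gadget sts)) ->
  three_edge_connected (glued eO o (edge_gadget sts)).
Proof.
move=> wf good simple A exA exnA.
have sym_g : symmetric (glued eO o (edge_gadget sts)) by apply: glued_sym.
wlog A0 : A exA exnA / ~~ A (inr ord0).
  move=> wl; case A0: (A (inr ord0)); last by apply: wl; rewrite ?A0.
  rewrite -cutC //; apply: wl; rewrite /= ?A0 //.
  by have [x Ax] := exA; exists x; rewrite /= Ax.
rewrite glue_cut //.
have ord01 (i : gvertex (edge_gadget sts)) : i = ord0 \/ i = ord_max.
  case: i => [[|[|]] //] lti; [left | right]; exact: val_inj.
case A1: (A (inr ord_max)).
  have cut1 : 0 < cut (@gadj (edge_gadget sts)) (A \o inr).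
    rewrite /cut /links (bigD1 ord_max) //= (bigD1 ord0) //= A1 A0.
    by [].
  have := good (predC (A \o inl)); rewrite cutC //.
  have -> : \sum_j (predC (A \o inl) (o j) != (gstub (edge_gadget sts) j == ord0)) =
     \sum_j (A (inl (o j)) != A (inr (gstub (edge_gadget sts) j))).
    apply: eq_bigr => j _ /=; case: (ord01 (gstub (edge_gadget sts) j)) => ->.
      by rewrite eqxx (negbTE A0); case: (A _).
    by rewrite A1; case: (A _).
  by move=> good_A; rewrite addnAC (leq_add good_A cut1).
have nA i : A (inr i) = false by case: (ord01 i) => ->; rewrite ?A1 ?(negbTE A0).
have [x Ax] : exists x, A (inl x).
  by have [[x|i] Ai] := exA; [exists x | rewrite nA in Ai].
apply: leq_trans (con_o (ex_intro (A \o inl) x Ax)) _.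
rewrite -addnA leq_add2l (leq_trans _ (leq_addl _ _)) //.
by apply: leq_sum => j _ /=; rewrite nA; case: (A _).
Qed.

Let o0 : 'I_4 := @Ordinal 4 0 isT.
Let o1 : 'I_4 := @Ordinal 4 1 isT.
Let o2 : 'I_4 := @Ordinal 4 2 isT.
Let o3 : 'I_4 := @Ordinal 4 3 isT.

(** Only stub 0 ends in both sets and only stub 3 in neither. So intersection and union each have a
    cut of at least 2, against a total of at most 2 by submodularity. *)
Lemma pairings_not_both_bad A B : cut eO A = 1 -> cut eO B = 1 ->
  (forall j : 'I_4, A (o j) = (j < 2)) -> (forall j : 'I_4, B (o j) = ~~ odd j) -> False.
Proof.
move=> cutA cutB oA oB; have := submodular_cut eO A B.
have : 3 <= cut eO [pred x | A x && B x] + \sum_j [pred x | A x && B x] (o j).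
  by apply: con_o; exists (o o0); rewrite /= oA oB.
have : 3 <= cut eO [pred x | A x || B x] + \sum_j ~~ [pred x | A x || B x] (o j).
  by apply: outside_connectedC => //; exists (o o3); rewrite /= oA oB.
under eq_bigr do rewrite /= oA oB; under [\sum_j [pred x | _] _]eq_bigr do rewrite /= oA oB.
by rewrite !big_ord_recl !big_ord0 /= cutA cutB; lia.
Qed.

Lemma bad_pairing_side A (t : rel O) rho : cut eO A = 1 ->
  (forall j : 'I_4, A (o j) = (j < 2)) -> subrel t eO -> symmetric t ->
  (forall i j : 'I_4, (nth 0 rho i == nth 0 rho j) = connect t (o i) (o j)) ->
  domino_side rho.
Proof.
move=> cutA oA sub_t sym_t rhoR; apply/implyP.
rewrite (rhoR o0 o2) (rhoR o1 o3) (rhoR o0 o1) => /andP[c02 c13].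
have [||u [v [cu Au nAv tuv]]] := @connect_crossing _ _ A _ _ c02; rewrite ?oA //.
have [||u' [v' [cu' Au' nAv' tuv']]] := @connect_crossing _ _ A _ _ c13; rewrite ?oA //.
(* Both tree paths leave [A] by its only edge, so the outer ends of stubs 0 and 1 both reach its
   tail. *)
have [eq_u _] := cut_eq_arcs cutA Au nAv (sub_t _ _ tuv) Au' nAv' (sub_t _ _ tuv').
by apply: connect_trans cu _; rewrite (sym_connect_sym sym_t) eq_u.
Qed.

End Pairings.

(** * Reducibility of the six subgraphs *)

(* Found by computer search. *)
Section Tables.
Local Notation T := Tree (only parsing).
Local Notation C := Cycle (only parsing).
Local Notation M := Match (only parsing).

Definition triangle_table : seq (seq color * seq color) :=
  [:: ([:: T; T; T], [:: M; T; T]);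
      ([:: M; T; T], [:: T; M; T]);
      ([:: T; M; T], [:: T; T; M]);
      ([:: T; T; M], [:: M; T; T]);
      ([:: C; C; T], [:: C; T; T]);
      ([:: C; T; C], [:: T; T; C]);
      ([:: T; C; C], [:: T; C; T])].

Definition K23_table : seq (seq color * seq color) :=
  [:: ([:: T; T; T], [:: M; T; T; T; M; T]);
      ([:: M; T; T], [:: T; M; T; T; T; M]);
      ([:: T; M; T], [:: M; T; T; T; T; M]);
      ([:: T; T; M], [:: M; T; T; T; M; T]);
      ([:: C; C; T], [:: C; C; T; T; T; T]);
      ([:: C; T; C], [:: C; T; C; T; T; T]);
      ([:: T; C; C], [:: T; C; C; T; T; T])].

Definition petersen_table : seq (seq color * seq color) :=
  [:: ([:: T; T; T], [:: C; C; C; C; C; T; T; T; T; T; T; T]);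
      ([:: T; T; T], [:: M; T; T; M; T; T; T; M; T; T; M; T]);
      ([:: T; T; T], [:: C; C; T; T; T; C; T; C; T; C; T; T]);
      ([:: C; C; T], [:: C; T; M; T; C; T; C; T; T; T; T; T]);
      ([:: C; T; C], [:: C; C; T; T; C; T; T; C; T; T; T; T]);
      ([:: T; C; C], [:: C; T; T; T; T; C; C; T; T; C; T; T])].

Definition claw_square_table : seq (seq color * seq color) :=
  [:: ([:: T; T; T; T], [:: T; T; M; T; T; T; M; M; M; T]);
      ([:: T; T; T; T], [:: M; T; M; T; T; M; T; T; T; T]);
      ([:: T; T; T; T], [:: C; C; C; C; T; M; T; T; T; T]);
      ([:: T; T; T; T], [:: T; T; T; M; M; T; T; T; M; M]);
      ([:: T; T; T; T], [:: C; C; C; C; M; T; T; T; T; T]);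
      ([:: C; C; T; T], [:: C; T; T; T; T; T; T; C; C; T]);
      ([:: C; T; C; T], [:: M; T; T; T; C; T; C; T; T; T]);
      ([:: T; C; T; C], [:: C; T; T; C; T; T; T; T; C; T]);
      ([:: T; T; C; C], [:: M; T; C; T; T; T; T; T; T; C]);
      ([:: T; T; T; T], [:: C; T; T; T; C; C; T; C; C; T]);
      ([:: C; C; T; T], [:: C; T; M; T; T; T; T; C; C; T]);
      ([:: C; T; C; T], [:: C; C; T; T; T; T; T; C; T; C]);
      ([:: T; C; T; C], [:: C; T; T; C; M; T; T; T; C; T]);
      ([:: T; T; C; C], [:: M; T; C; T; M; T; T; T; T; C]);
      ([:: C; T; T; C], [:: T; M; T; C; T; M; T; C; T; T]);
      ([:: T; C; C; T], [:: T; C; T; M; T; T; T; T; C; C])].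

Definition twin_house_table : seq (seq color * seq color) :=
  [:: ([:: T; T; T; T], [:: M; T; T; T; M; M; T]);
      ([:: T; T; T; T], [:: M; T; T; M; T; T; T]);
      ([:: T; T; T; T], [:: T; T; T; C; C; C; C]);
      ([:: T; T; T; T], [:: M; T; T; M; T; T; M]);
      ([:: C; C; T; T], [:: C; T; T; M; T; T; T]);
      ([:: C; T; C; T], [:: T; C; T; C; T; T; T]);
      ([:: T; C; T; C], [:: T; T; C; T; T; T; C]);
      ([:: T; T; C; C], [:: T; T; T; C; C; T; T]);
      ([:: M; T; T; M], [:: T; T; M; M; T; T; T]);
      ([:: T; M; M; T], [:: T; M; T; T; T; T; M]);
      ([:: C; C; T; T], [:: C; T; T; M; T; T; M]);
      ([:: C; T; C; T], [:: C; T; C; T; T; C; T]);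
      ([:: T; C; T; C], [:: C; C; T; T; C; T; T]);
      ([:: T; T; C; C], [:: M; T; T; C; C; T; T]);
      ([:: C; T; T; C], [:: C; T; C; T; T; T; C]);
      ([:: M; M; T; T], [:: T; T; T; M; T; T; M]);
      ([:: M; T; M; T], [:: T; T; M; T; M; T; T]);
      ([:: T; C; C; T], [:: C; C; T; C; T; T; T]);
      ([:: T; M; T; M], [:: T; M; T; T; T; M; T])].

Definition domino_table : seq (seq color * seq color) :=
  [:: ([:: T; T; T; T], [:: M; T; M; T; T; T; M]);
      ([:: T; T; T; T], [:: M; T; T; M; T; T; T]);
      ([:: T; T; T; T], [:: C; T; C; T; C; C; T]);
      ([:: T; T; T; T], [:: T; T; T; T; M; M; M]);
      ([:: T; T; T; T], [:: T; C; T; C; T; C; C]);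
      ([:: C; C; T; T], [:: C; C; T; T; T; T; T]);
      ([:: C; T; C; T], [:: T; M; T; T; C; T; T]);
      ([:: T; C; T; C], [:: M; T; T; T; T; T; C]);
      ([:: T; T; C; C], [:: T; T; C; C; T; T; T]);
      ([:: C; C; T; T], [:: C; C; M; T; T; T; T]);
      ([:: C; T; C; T], [:: T; T; T; T; C; M; M]);
      ([:: T; C; T; C], [:: T; T; T; T; M; M; C]);
      ([:: T; T; C; C], [:: M; T; C; C; T; T; T]);
      ([:: C; T; T; C], [:: C; C; T; T; T; T; C]);
      ([:: T; C; C; T], [:: C; C; T; T; C; T; T]);
      ([:: M; T; T; M], [:: T; M; M; T; T; T; T]);
      ([:: T; M; M; T], [:: M; T; T; M; T; T; T])].

End Tables.

(** The edge lists repeat those of the forbidden graphs, so that an embedding of one is by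
    conversion a map out of the gadget. The stubs sit at the vertices of degree 2. *)
Definition triangle_gadget := Gadget 2 [:: (0,1); (1,2); (2,0)] [:: 0; 1; 2].
Definition K23_gadget :=
  Gadget 4 [:: (0,2); (0,3); (0,4); (1,2); (1,3); (1,4)] [:: 2; 3; 4].
Definition petersen_gadget :=
  Gadget 8 [:: (0,1); (1,2); (2,3); (3,4); (4,0); (0,5); (1,6); (2,7); (3,8);
               (5,7); (6,8); (8,5)] [:: 4; 6; 7].
Definition claw_square_gadget :=
  Gadget 7 [:: (0,1); (1,2); (2,3); (3,0); (7,4); (7,5); (7,6); (4,0); (5,1); (6,2)]
    [:: 4; 5; 6; 3].
Definition twin_house_gadget :=
  Gadget 5 [:: (0,1); (0,4); (1,5); (4,2); (4,3); (5,2); (5,3)] [:: 0; 1; 2; 3].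
Definition domino_gadget :=
  Gadget 5 [:: (0,1); (1,2); (3,4); (4,5); (0,3); (1,4); (2,5)] [:: 0; 2; 3; 5].

Lemma triangle_reducible : reducible 3 vertex_gadget triangle_gadget predT triangle_table.
Proof. by vm_compute. Qed.

Lemma K23_reducible : reducible 3 vertex_gadget K23_gadget predT K23_table.
Proof. by vm_compute. Qed.

Lemma petersen_reducible : reducible 3 vertex_gadget petersen_gadget predT petersen_table.
Proof. by vm_compute. Qed.

Lemma claw_square_reducible_0011 :
  reducible 4 (edge_gadget [:: 0; 0; 1; 1]) claw_square_gadget predT claw_square_table.
Proof. by vm_compute. Qed.

(** The second pairing is resorted to when the first is bad, and then [domino_side] holds. *)
Lemma claw_square_reducible_0101 :
  reducible 4 (edge_gadget [:: 0; 1; 0; 1]) claw_square_gadget domino_side claw_square_table.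
Proof. by vm_compute. Qed.

Lemma twin_house_reducible_0011 :
  reducible 4 (edge_gadget [:: 0; 0; 1; 1]) twin_house_gadget predT twin_house_table.
Proof. by vm_compute. Qed.

Lemma twin_house_reducible_0101 :
  reducible 4 (edge_gadget [:: 0; 1; 0; 1]) twin_house_gadget domino_side twin_house_table.
Proof. by vm_compute. Qed.

Lemma domino_reducible_0011 :
  reducible 4 (edge_gadget [:: 0; 0; 1; 1]) domino_gadget predT domino_table.
Proof. by vm_compute. Qed.

Lemma domino_reducible_0101 :
  reducible 4 (edge_gadget [:: 0; 1; 0; 1]) domino_gadget domino_side domino_table.
Proof. by vm_compute. Qed.

(** * Transport along isomorphisms *)

Section Transport.
Variables (V W : finType) (h : V -> W) (eV : rel V) (eW : rel W).
Hypotheses (bij_h : bijective h) (iso_h : forall a b, eW (h a) (h b) = eV a b).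

Lemma three_edge_connected_iso : three_edge_connected eW -> three_edge_connected eV.
Proof.
have [g hK gK] := bij_h; move=> ec A [a Aa] [b nAb].
have -> : cut eV A = cut eW (A \o g).
  rewrite /cut /links [RHS](reindex h) /=; last exact: onW_bij.
  apply: eq_bigr => x _; rewrite [RHS](reindex h) /=; last exact: onW_bij.
  by apply: eq_bigr => y _; rewrite !hK iso_h.
by apply: ec; [exists (h a) | exists (h b)]; rewrite /= hK.
Qed.

Lemma three_regular_iso : three_regular eW -> three_regular eV.
Proof.
move=> reg x; rewrite -(reg (h x)) [RHS](reindex h) /=; last exact: onW_bij.
by apply: eq_bigr => y _; rewrite iso_h.
Qed.

Lemma decomposable_iso : decomposable eV -> decomposable eW.
Proof.
have [g hK gK] := bij_h => -[c def_c dec_c].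
exists (fun x y => c (g x) (g y)) => [x y|].
  by rewrite -def_c -iso_h !gK.
by apply: (decomposing_bij (f := g)) dec_c; first by exists h.
Qed.

End Transport.

Lemma contains_of_seq (T : finType) (e : rel T) (x0 : T) (xs : seq T) E :
  symmetric e -> uniq xs -> all (fun p => e (nth x0 xs p.1) (nth x0 xs p.2)) E ->
  contains_subgraph e (@graph_of (size xs) E).
Proof.
move=> sym_e Uxs /allP homE; exists (fun i => nth x0 xs i); split=> [i j|i j].
  by move/eqP; rewrite nth_uniq // => /eqP/val_inj.
by case/orP=> /homE //; rewrite sym_e.
Qed.

(** A fixed-point-free involution matches the [j < p j] with the others, so 3 would be even. Hence
    chords cannot pair up three stubs. *)
Lemma no_involution3 (p : 'I_3 -> 'I_3) :
  (forall j, p j != j) -> (forall j, p (p j) = j) -> False.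
Proof.
move=> neq_p pK.
suff: #|[set: 'I_3]| = 2 * #|[set j : 'I_3 | j < p j]|.
  by rewrite cardsT card_ord; lia.
have inj_p : injective p := can_inj pK.
have -> : [set: 'I_3] = [set j : 'I_3 | j < p j] :|: p @: [set j : 'I_3 | j < p j].
  apply/setP=> j; rewrite !inE -[in X in _ || X](pK j) mem_imset // inE pK.
  by rewrite -neq_ltn; have := neq_p j; rewrite eq_sym => ->.
rewrite cardsU card_imset // (_ : _ :&: _ = set0) ?cards0 ?subn0 ?mul2n ?addnn //.
apply/setP=> j; rewrite !inE -[in X in _ && X](pK j) mem_imset // inE pK.
by case: ltngtP.
Qed.

(** * The minimal counterexample *)

Section MinimalCounterexample.
Variables (T : finType) (e : rel T).
Hypotheses (He : simple_graph e) (Hcub : cubic e) (H3c : k_connected 3 e).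
Hypothesis Hno : ~ has_3decomposition e.
Hypothesis Hmin : forall (T' : finType) (e' : rel T'),
  simple_graph e' -> cubic e' -> k_connected 3 e' ->
  ~ has_3decomposition e' -> #|T| <= #|T'|.

Let sym_e : symmetric e := He.1.
Let irr_e : irreflexive e := He.2.

Lemma minimal_three_edge_connected : three_edge_connected e.
Proof. exact: edge_connected_of_connected. Qed.

Lemma minimal_indecomposable : ~ decomposable e.
Proof. by move=> dec_e; apply: Hno; apply: decomposable_has_3decomposition. Qed.

Section Model.
Variables (O : finType) (eO : rel O) (k : nat) (o : 'I_k -> O) (g : gadget).
Variable h : O + gvertex g -> T.
Hypotheses (bij_h : bijective h) (iso_h : forall a b, e (h a) (h b) = glued eO o g a b).

Lemma model_outside_sym : symmetric eO.
Proof. by move=> x y; have := sym_e (h (inl x)) (h (inl y)); rewrite !iso_h. Qed.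

Lemma model_outside_irr : irreflexive eO.
Proof. by move=> x; have := irr_e (h (inl x)); rewrite iso_h. Qed.

Lemma model_three_edge_connected : three_edge_connected (glued eO o g).
Proof. exact: three_edge_connected_iso bij_h iso_h minimal_three_edge_connected. Qed.

Lemma model_three_regular : three_regular (glued eO o g).
Proof. exact/(three_regular_iso bij_h iso_h)/cubic_three_regular. Qed.

(** The exchanged graph is smaller, so by minimality it cannot fail to have a 3-decomposition; the
    double negation suffices since the goal is [False]. *)
Lemma model_irreducible g' : well_formed k g' -> top g' < top g ->
  three_regular (glued eO o g') -> three_edge_connected (glued eO o g') ->
  (decomposable (glued eO o g') -> decomposable (glued eO o g)) -> False.
Proof.
move=> wf lt_top reg ec red; have cub := (cubic_three_regular _).2 reg.
have sym_g' : symmetric (glued eO o g') by apply: glued_sym; apply: model_outside_sym.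
have irr_g' : irreflexive (glued eO o g') by apply: glued_irr => //; apply: model_outside_irr.
have con : k_connected 3 (glued eO o g').
  by apply: connected_of_edge_connected => //; apply: (inr ord0).
have : ~ ~ has_3decomposition (glued eO o g').
  move=> /(Hmin (conj sym_g' irr_g') cub con); rewrite -(bij_eq_card bij_h).
  by rewrite !card_sum !card_ord leq_add2l ltnS leqNgt lt_top.
apply=> dec3; apply: minimal_indecomposable.
apply: (decomposable_iso bij_h iso_h); apply: red.
by apply: has_3decomposition_decomposable => //; apply: leq_trans con.1.
Qed.

End Model.

(** Chords fail by parity. A single outer vertex is handled by [closes_up]; otherwise the outer ends
    are distinct and the gadget is exchanged for a vertex. *)
Lemma three_stub_gadget_absent g table (f : gvertex g -> T) :
  well_formed 3 g -> cubic_gadget 3 g -> uniq (gstubs g) -> 0 < top g ->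
  has (closes_up 3 g) table -> reducible 3 vertex_gadget g predT table ->
  injective f -> (forall i j, gadj i j -> e (f i) (f j)) -> False.
Proof.
move=> wf cub Ug top_gt0 /hasP[w _ closes] red inj_f hom_f.
have [|[p chords]] := glued_model_or_chords sym_e irr_e Hcub wf cub Ug inj_f hom_f
  minimal_three_edge_connected isT; last first.
  by apply: (no_involution3 (p := p)) => j; have [] := chords j.
case=> O [eO [o [h [bij_h simple iso_h]]]].
have symO := model_outside_sym iso_h; have irrO := model_outside_irr iso_h.
have con_o := glued_outside_connected simple (model_three_edge_connected bij_h iso_h).
have reg_o := glued_outside_regular simple (model_three_regular bij_h iso_h).
have [inj_o|allO] := three_stubs_inj symO con_o reg_o erefl; last first.
  apply/minimal_indecomposable/(decomposable_iso bij_h iso_h).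
  exact: closes_up_decomposable (o ord0) wf simple irrO allO closes.
have simple' : simple_stubs o (@gstub 3 vertex_gadget) by move=> i j /inj_o.
apply: (model_irreducible bij_h iso_h (g' := vertex_gadget)) => //.
- by apply: glued_regular.
- by apply: glued_vertex_connected.
- by apply: (reducible_decomposable _ wf _ simple' simple _ red).
Qed.

(** Four stubs could be paired by chords, which is left to each subgraph to exclude. Otherwise one
    of two pairings allows an exchange for an edge. *)
Lemma four_stub_gadget_absent g table (f : gvertex g -> T) :
  well_formed 4 g -> cubic_gadget 4 g -> uniq (gstubs g) -> 1 < top g ->
  reducible 4 (edge_gadget [:: 0; 0; 1; 1]) g predT table ->
  reducible 4 (edge_gadget [:: 0; 1; 0; 1]) g domino_side table ->
  injective f -> (forall i j, gadj i j -> e (f i) (f j)) ->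
  ~ (exists p : 'I_4 -> 'I_4, forall j,
    [/\ p j != j, p (p j) = j, e (f (gstub g j)) (f (gstub g (p j)))
      & ~~ gadj (gstub g j) (gstub g (p j))]) -> False.
Proof.
move=> wf cub Ug top_gt1 red1 red2 inj_f hom_f no_chord.
have [|//] := glued_model_or_chords sym_e irr_e Hcub wf cub Ug inj_f hom_f
  minimal_three_edge_connected isT.
case=> O [eO [o [h [bij_h simple iso_h]]]].
have symO := model_outside_sym iso_h; have irrO := model_outside_irr iso_h.
have con_o := glued_outside_connected simple (model_three_edge_connected bij_h iso_h).
have reg_o := glued_outside_regular simple (model_three_regular bij_h iso_h).
pose q sts : pred 'I_4 := fun j => gstub (edge_gadget sts) j == ord0.
have irreducible_q sts (side : pred (seq nat)) : well_formed 4 (edge_gadget sts) ->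
    cubic_gadget 4 (edge_gadget sts) -> \sum_j q sts j = 2 -> good_pairing eO o (q sts) ->
    (forall (t : rel O) rho, subrel t eO -> symmetric t ->
      (forall i j : 'I_4, (nth 0 rho i == nth 0 rho j) = connect t (o i) (o j)) ->
      side rho) ->
    reducible 4 (edge_gadget sts) g side table -> False.
  move=> wf' cub' sumq good side_ok red.
  have simple' : simple_stubs o (@gstub 4 (edge_gadget sts)).
    move=> i j eq_o eq_st.
    by apply: (good_pairing_simple_stubs symO reg_o sumq good eq_o); rewrite /q eq_st.
  apply: (model_irreducible bij_h iso_h wf') => //.
  - by apply: glued_regular.
  - by apply: glued_edge_connected.
  - exact: (reducible_decomposable wf' wf isT simple' simple side_ok red).
have qE sts j : well_formed 4 (edge_gadget sts) -> q sts j = (nth 0 sts j == 0).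
  by move=> wf'; rewrite /q -(inj_eq val_inj) /= (gstub_val wf').
have q1 (j : 'I_4) : q [:: 0; 0; 1; 1] j = (j < 2).
  by rewrite qE //; case: j => [[|[|[|[|]]]]].
have q2 (j : 'I_4) : q [:: 0; 1; 0; 1] j = ~~ odd j.
  by rewrite qE //; case: j => [[|[|[|[|]]]]].
have sum1 : \sum_j q [:: 0; 0; 1; 1] j = 2.
  by under eq_bigr do rewrite q1; rewrite !big_ord_recl big_ord0.
have sum2 : \sum_j q [:: 0; 1; 0; 1] j = 2.
  by under eq_bigr do rewrite q2; rewrite !big_ord_recl big_ord0.
(* If the first pairing is good it gives the contradiction. If not, the bridge around [A] makes the
   second good and yields [domino_side]. *)
apply: (irreducible_q [:: 0; 0; 1; 1] predT) => // A.
rewrite leqNgt ltnS; apply/negP=> /(bad_pairing symO con_o sum1)[cutA oA].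
have {}oA j : A (o j) = (j < 2) by rewrite oA q1.
apply: (irreducible_q [:: 0; 1; 0; 1] domino_side) => // [B|t rho].
  rewrite leqNgt ltnS; apply/negP=> /(bad_pairing symO con_o sum2)[cutB oB].
  by apply: (pairings_not_both_bad symO con_o cutA cutB oA) => j; rewrite oB q2.
exact: bad_pairing_side cutA oA.
Qed.

Section SubgraphMaps.
Variables (g : gadget) (f : gvertex g -> T).
Hypotheses (inj_f : injective f) (hom_f : forall i j, gadj i j -> e (f i) (f j)).

Lemma hom_inord i j : i <= top g -> j <= top g ->
  ((i, j) \in gedges g) || ((j, i) \in gedges g) -> e (f (inord i)) (f (inord j)).
Proof. by move=> lei lej ij; apply: hom_f; rewrite /gadj /graph_of !inordK. Qed.

End SubgraphMaps.

Lemma contains_K3 x y z : e x y -> e y z -> e z x -> contains_subgraph e K3.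
Proof.
move=> exy eyz ezx.
apply: (@contains_of_seq T e x [:: x; y; z]) => //=; last by rewrite exy eyz ezx.
rewrite !inE !andbT negb_or -andbA; apply/and3P; split.
- by apply: contraTneq exy => ->; rewrite irr_e.
- by apply: contraTneq ezx => ->; rewrite irr_e.
- by apply: contraTneq eyz => ->; rewrite irr_e.
Qed.

Lemma K3_free : ~ contains_subgraph e K3.
Proof.
case=> f [inj_f hom_f].
by apply: (three_stub_gadget_absent _ _ _ _ _ triangle_reducible inj_f hom_f).
Qed.

Lemma K23_free : ~ contains_subgraph e K23.
Proof.
case=> f [inj_f hom_f].
by apply: (three_stub_gadget_absent _ _ _ _ _ K23_reducible inj_f hom_f).
Qed.

Lemma petersen_minus_vertex_free : ~ contains_subgraph e petersen_minus_vertex.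
Proof.
case=> f [inj_f hom_f].
by apply: (three_stub_gadget_absent _ _ _ _ _ petersen_reducible inj_f hom_f).
Qed.

Let o0 : 'I_4 := @Ordinal 4 0 isT.
Let o1 : 'I_4 := @Ordinal 4 1 isT.
Let o2 : 'I_4 := @Ordinal 4 2 isT.
Let o3 : 'I_4 := @Ordinal 4 3 isT.

Lemma involution4 (p : 'I_4 -> 'I_4) : p o0 != o0 -> [\/ p o0 = o1, p o0 = o2 | p o0 = o3].
Proof.
case: (p o0) => [[|[|[|[|]]]]] lti //= _.
- by constructor 1; apply: val_inj.
- by constructor 2; apply: val_inj.
- by constructor 3; apply: val_inj.
Qed.

(** A chord from [b1] closes a triangle: with [c] if it ends at [b2] or [b3], with [a1] if it ends
    at [a4]. *)
Lemma claw_square_free : ~ contains_subgraph e claw_square.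
Proof.
case=> f [inj_f hom_f]; have hom := hom_inord (g := claw_square_gadget) hom_f.
apply: (four_stub_gadget_absent _ _ _ _ claw_square_reducible_0011
  claw_square_reducible_0101 inj_f hom_f) => //.
case=> p /(_ o0)[/involution4 p0 _ chord _]; apply: K3_free; move: chord.
case: p0 => -> /= chord.
- by apply: (contains_K3 chord); apply: (hom _ 7) || apply: (hom 7).
- by apply: (contains_K3 chord); apply: (hom _ 7) || apply: (hom 7).
- by apply: (contains_K3 chord); apply: (hom _ 0) || apply: (hom 0).
Qed.

(** A chord from [p1] cannot end at [p2], already a gadget neighbour; at [p3] or [p4] it closes a
    triangle with [p5]. *)
Lemma twin_house_free : ~ contains_subgraph e twin_house.
Proof.
case=> f [inj_f hom_f]; have hom := hom_inord (g := twin_house_gadget) hom_f.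
apply: (four_stub_gadget_absent _ _ _ _ twin_house_reducible_0011
  twin_house_reducible_0101 inj_f hom_f) => //.
case=> p /(_ o0)[/involution4 p0 _ chord]; case: p0 chord => -> /= chord nadj.
- by case/negP: nadj; rewrite /gadj /graph_of !inordK.
- by apply: K3_free; apply: (contains_K3 chord); apply: (hom _ 4) || apply: (hom 4).
- by apply: K3_free; apply: (contains_K3 chord); apply: (hom _ 4) || apply: (hom 4).
Qed.

(** A chord [a1 a3] closes a triangle with [a2], and [a1 b1] is a gadget edge. The chords [a1 b3]
    and [a3 b1] together turn the domino into [K_{3,3}], which contains [K_{2,3}] with sides
    [a1, a3] and [a2, b1, b3]. *)
Lemma domino_free : ~ contains_subgraph e domino.
Proof.
case=> f [inj_f hom_f]; have hom := hom_inord (g := domino_gadget) hom_f.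
apply: (four_stub_gadget_absent _ _ _ _ domino_reducible_0011
  domino_reducible_0101 inj_f hom_f) => //.
case=> p chords; have [neq0 p00 chord0 nadj0] := chords o0.
case: (involution4 neq0) => p0; rewrite p0 in p00 chord0 nadj0.
- by apply: K3_free; apply: (contains_K3 chord0); apply: (hom _ 1) || apply: (hom 1).
- by case/negP: nadj0; rewrite /gadj /graph_of !inordK.
have [neq1 p11 chord1 _] := chords o1.
(* Stubs 0 and 3 are already paired with each other. *)
have p1 : p o1 = o2.
  move: neq1 p11; case: (p o1) => [[|[|[|[|]]]]] lti //= neq1 p11.
  - by move: p11; rewrite (_ : Ordinal lti = o0) ?p0 //; apply: val_inj.
  - exact: val_inj.
  - by move: p11; rewrite (_ : Ordinal lti = o3) ?p00 //; apply: val_inj.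
rewrite p1 in chord1; apply: K23_free.
pose v i := f (inord i : gvertex domino_gadget).
have e05 : e (v 0) (v 5) := chord0.
have e23 : e (v 2) (v 3) := chord1.
have Uv : uniq (map v [:: 0; 2; 1; 3; 5]).
  rewrite map_inj_in_uniq // => i j Li Lj /inj_f/(congr1 val).
  have lt6 : all (fun i => i < 6) [:: 0; 2; 1; 3; 5] by [].
  by rewrite /= !inordK // (allP lt6).
apply: (@contains_of_seq T e (v 0) _ _ sym_e Uv) => /=.
by rewrite e05 e23 !hom.
Qed.

End MinimalCounterexample.

Theorem theorem4 (T : finType) (e : rel T)
  (He : simple_graph e) (Hcub : cubic e) (H3c : k_connected 3 e)
  (Hno : ~ has_3decomposition e)
  (Hmin : forall (T' : finType) (e' : rel T'),
      simple_graph e' -> cubic e' -> k_connected 3 e' ->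
      ~ has_3decomposition e' -> #|T| <= #|T'|) :
  ~ contains_subgraph e K3 /\
  ~ contains_subgraph e K23 /\
  ~ contains_subgraph e petersen_minus_vertex /\
  ~ contains_subgraph e claw_square /\
  ~ contains_subgraph e twin_house /\
  ~ contains_subgraph e domino.
Proof.
split; first exact: K3_free.
split; first exact: K23_free.
split; first exact: petersen_minus_vertex_free.
split; first exact: claw_square_free.
split; first exact: twin_house_free.
exact: domino_free.
Qed.
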